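(* Suppose that: (A) $F:\mathbb{R}^d\to\mathbb{R}$ is continuously differentiable and $\|\nabla F(x')-\nabla F(x)\|_2\le L\|x'-x\|_2$ for all $x,x'\in\mathbb{R}^d$, with $0<L<\infty$; (B) $F$ is twice differentiable and bounded below by a scalar $F_{\inf}$, and the mapping $x\mapsto\|\nabla F(x)\|_2^2$ has Lipschitz-continuous derivatives with Lipschitz constant $L_G>0$; (C) the random directions $\zeta_k$ satisfy the direction assumption of the context; (D) the variance assumption of the context holds with constants $M,M_V\ge0$. Let $M_G=M_V+2$. Suppose that $\{x_k\}$ is generated by the SGFD method with stepsizes $\alpha_k=\frac{\beta}{k+\sigma}$, $k\in\mathbb{N}$, where $\beta>0$ and $\sigma>0$ are such that $\alpha_1\le\frac1{LM_G}$. Then $$\lim_{k\to\infty}\mathbb{E}\big[\|\nabla F(x_k)\|_2^2\big]=0.$$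
   Context: $F(x)=\mathbb{E}_\xi[f(x,\xi)]=\int_\Xi f(x,\xi)\,dP(\xi)$ for a collection of real-valued functions $f(\cdot,\xi)$ on $\mathbb{R}^d$ and a probability distribution $P$ on $\Xi$. SGFD method: from a given $x_1\in\mathbb{R}^d$, $x_{k+1}=x_k+s(x_k,\xi_k,\alpha_k,\zeta_k)$ with stepsize $\alpha_k>0$, where the step is one of the following four choices ($n_k,q_k$ are positive integer sample sizes, all $\xi$'s are distributed as $P$, all $\zeta$'s with index $k$ as $\zeta_k$): (1) $(f(x_k,\xi_k)-f(x_k+\alpha_k\zeta_k,\xi_k))\zeta_k$; (2) $\frac1{n_k}\sum_{i=1}^{n_k}(f(x_k,\xi_{k,i})-f(x_k+\alpha_k\zeta_k,\xi_{k,i}))\zeta_k$; (3) $\frac1{n_k}\sum_{i=1}^{n_k}\big[\frac1{q_k}\sum_{j=1}^{q_k}(f(x_k,\xi_{k,i,j})-f(x_k+\alpha_k\zeta_{k,i},\xi_{k,i,j}))\big]\zeta_{k,i}$; (4) $\frac1{n_k}\sum_{i=1}^{n_k}(f(x_k,\xi_{k,i})-f(x_k+\alpha_k\zeta_{k,i},\xi_{k,i}))\zeta_{k,i}$. The random variables $\{\xi_k\}$, $\{\zeta_k\}$ are i.i.d. over $k$ and jointly independent, so that $\mathbb{E}_{\xi_k,\zeta_k}[s(x_k,\xi_k,\alpha_k,\zeta_k)]=\mathbb{E}_{\zeta_k}[(F(x_k)-F(x_k+\alpha_k\zeta_k))\zeta_k]$. Here $\mathbb{E}_{\xi_k,\zeta_k}$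 is the expectation over the $k$-th seeds with $x_k$ held fixed, and $\mathbb{E}$ is the total expectation over all random variables. Direction assumption: the $\zeta_k\in\mathbb{R}^d$ are i.i.d.; $\mathbb{E}[\zeta_k^{(i)}]=0$ for all $i$; $\mathbb{E}[\zeta_k^{(i)}\zeta_k^{(j)}]=1$ if $i=j$ and $0$ otherwise; and every component is bounded, $|\zeta_k^{(i)}|\le r_\zeta$ for all $i$, or has a finite nonzero fourth moment, $\mathbb{E}[(\zeta_k^{(i)})^4]\le m_\zeta^{(4)}$ for all $i$. Variance assumption: for all $k\in\mathbb{N}$, $\mathbb{V}_{\xi_k,\zeta_k}[s(x_k,\xi_k,\alpha_k,\zeta_k)]\le\alpha_k^2M+\alpha_k^2M_V\|\nabla F(x_k)\|_2^2$, where $\mathbb{V}_\theta[s]=\mathbb{E}_\theta[\|s\|_2^2]-\|\mathbb{E}_\theta[s]\|_2^2$. *)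

(* Defs.v *)
From HB Require Import structures.
From mathcomp Require Import all_boot all_order all_algebra finmap.
From mathcomp Require Import all_classical all_reals all_analysis.

Set Implicit Arguments.
Unset Strict Implicit.
Unset Printing Implicit Defensive.

Import Order.TTheory GRing.Theory Num.Theory.
Import numFieldNormedType.Exports.

Local Open Scope classical_set_scope.
Local Open Scope ring_scope.

(* Row vectors carry the product sigma-algebra generated by the coordinates
   (as the library does for tuples); over R^d this is the Borel sigma-algebra. *)
Definition measure_rV_display : measure_display -> measure_display.
Proof. exact. Qed.

Section measurable_rV.
Context {disp : measure_display} {T : sigmaRingType disp}.
Variable d : nat.

Let coord : 'I_d -> 'rV[T]_d -> T := fun i v => v ord0 i.

Let rV_set0 : g_sigma_preimage coord set0.
Proof. exact: sigma_algebra0. Qed.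

Let rV_setC A : g_sigma_preimage coord A -> g_sigma_preimage coord (~` A).
Proof. exact: sigma_algebraC. Qed.

Let rV_bigcup (A : (set 'rV[T]_d)^nat) :
  (forall i, g_sigma_preimage coord (A i)) ->
  g_sigma_preimage coord (\bigcup_i (A i)).
Proof. exact: sigma_algebra_bigcup. Qed.

HB.instance Definition _ := @isMeasurable.Build (measure_rV_display disp)
  ('rV[T]_d) (g_sigma_preimage coord) rV_set0 rV_setC rV_bigcup.

End measurable_rV.

Section euclidean.
Context {R : realType} {d : nat}.
Implicit Types (F : 'rV[R]_d -> R).

(* The library's norm on row vectors is the max norm; it defines the same
   topology and derivatives, but not the same Lipschitz constants. *)
Definition norm2 (v : 'rV[R]_d) : R := Num.sqrt (\sum_i v ord0 i ^+ 2).

Definition grad F (x : 'rV[R]_d) : 'rV[R]_d :=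
  \row_i 'D_(delta_mx ord0 i) F x.

Definition continuously_differentiable F : Prop :=
  (forall x, differentiable F x) /\ continuous (grad F).

Definition twice_differentiable F : Prop :=
  (forall x, differentiable F x) /\ (forall x, differentiable (grad F) x).

Definition lipschitz_grad (K : R) F : Prop :=
  forall x x', norm2 (grad F x' - grad F x) <= K * norm2 (x' - x).

End euclidean.

Section probability.
Context {dO : measure_display} {Omega : measurableType dO} {R : realType}.
Variable Q : probability Omega R.

Definition mutually_independent {I : choiceType} (D : set I)
    (S : I -> set (set Omega)) : Prop :=
  forall (J : {fset I}) (E : I -> set Omega),
    [set` J] `<=` D -> (forall i, i \in J -> S i (E i)) ->
    Q (\bigcap_(i in [set` J]) E i) = (\prod_(i <- J) Q (E i))%E.

Definition expected_vector {d : nat} (S : Omega -> 'rV[R]_d) : 'rV[R]_d :=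
  \row_i fine ('E_Q[fun w => S w ord0 i])%E.

(* Equal to +oo when S is not square-integrable, so that any finite upper
   bound on it includes square-integrability. *)
Definition vector_variance {d : nat} (S : Omega -> 'rV[R]_d) : \bar R :=
  ('E_Q[fun w => (norm2 (S w) ^+ 2)%R] - (norm2 (expected_vector S) ^+ 2)%:E)%E.

Definition direction_assumption {d : nat} (z : Omega -> 'rV[R]_d)
    (r m4 : R) : Prop :=
  [/\ forall i, ('E_Q[fun w => z w ord0 i] = 0)%E,
      forall i j, ('E_Q[fun w => (z w ord0 i * z w ord0 j)%R]
                   = ((i == j)%:R)%:E)%E
    & (forall i, {ae Q, forall w, `|z w ord0 i| <= r}) \/
      (forall i, (0 < 'E_Q[fun w => (z w ord0 i ^+ 4)%R])%E /\
                 ('E_Q[fun w => (z w ord0 i ^+ 4)%R] <= m4%:E)%E)].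

End probability.

Inductive scheme : Set :=
  | SingleSample | SharedDirection | NestedSamples | PairedSamples.

(* In iteration k the method draws the directions zeta k i and the data
   xi k i j for i < outer_size and j < inner_size. In particular the data
   samples of SharedDirection are xi k 0 j. *)
Definition outer_size (c : scheme) (n q : nat) : nat :=
  match c with
  | SingleSample => 1
  | SharedDirection => 1
  | NestedSamples => n
  | PairedSamples => n
  end.

Definition inner_size (c : scheme) (n q : nat) : nat :=
  match c with
  | SingleSample => 1
  | SharedDirection => n
  | NestedSamples => q
  | PairedSamples => 1
  end.

Section sgfd.
Context {R : realType} {d : nat} {Xi : Type}.
Variable f : 'rV[R]_d -> Xi -> R.

Definition sgfd_step (c : scheme) (n q : nat) (xi : nat -> nat -> Xi)
    (zeta : nat -> 'rV[R]_d) (a : R) (x : 'rV[R]_d) : 'rV[R]_d :=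
  match c with
  | SingleSample =>
      (f x (xi 0 0) - f (x + a *: zeta 0) (xi 0 0)) *: zeta 0
  | SharedDirection =>
      n%:R^-1 *: \sum_(i < n)
        (f x (xi 0 i) - f (x + a *: zeta 0) (xi 0 i)) *: zeta 0
  | NestedSamples =>
      n%:R^-1 *: \sum_(i < n)
        (q%:R^-1 * \sum_(j < q)
          (f x (xi i j) - f (x + a *: zeta i) (xi i j))) *: zeta i
  | PairedSamples =>
      n%:R^-1 *: \sum_(i < n)
        (f x (xi i 0) - f (x + a *: zeta i) (xi i 0)) *: zeta i
  end.

End sgfd.

(* Iterations are numbered from 0: index k stands for the 1-based index k+1,
   so stepsize beta sigma 0 is alpha_1 = beta / (1 + sigma). *)
Definition stepsize {R : realType} (beta sigma : R) (k : nat) : R :=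
  beta / (k.+1%:R + sigma).

Section seeds.
Context {R : realType} {d : nat} {dX dO : measure_display}.
Context {Xi : measurableType dX} {Omega : measurableType dO}.
Variables (P : probability Xi R) (Q : probability Omega R).
Variables (c : scheme) (n q : nat -> nat).
Variables (xi : nat -> nat -> nat -> {RV Q >-> Xi})
          (zeta : nat -> nat -> {RV Q >-> 'rV[R]_d}).

Definition drawn (s : (nat * nat * nat) + (nat * nat)) : Prop :=
  match s with
  | inl (k, i, j) => (i < outer_size c (n k) (q k))%N /\
                     (j < inner_size c (n k) (q k))%N
  | inr (k, i) => (i < outer_size c (n k) (q k))%N
  end.

Definition seed_events (s : (nat * nat * nat) + (nat * nat)) :
    set (set Omega) :=
  match s with
  | inl (k, i, j) => preimage_set_system setT (xi k i j) measurable
  | inr (k, i) => preimage_set_system setT (zeta k i) measurable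
  end.

Definition seeds_assumption : Prop :=
  [/\ forall k i j, drawn (inl (k, i, j)) ->
        forall A, measurable A -> distribution Q (xi k i j) A = P A,
      forall k i, drawn (inr (k, i)) ->
        forall A, measurable A ->
          distribution Q (zeta k i) A = distribution Q (zeta 0 0) A
    & mutually_independent Q [set s | drawn s] seed_events].

End seeds.

(* Main.v *)
Require Import Defs.
From HB Require Import structures.
From mathcomp Require Import all_boot all_order all_algebra finmap.
From mathcomp Require Import all_classical all_reals all_analysis.
From mathcomp Require Import measurable_realfun ring lra.

Set Implicit Arguments.
Unset Strict Implicit.
Unset Printing Implicit Defensive.

Import Order.TTheory GRing.Theory Num.Theory.
Import numFieldNormedType.Exports.

Local Open Scope classical_set_scope.
Local Open Scope ring_scope.

(** The idea is that the mean step is a gradient step up to a small bias, so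
    that the objective decreases along the trajectory in mean, while the square
    norm of the gradient changes slowly. Write [G x = norm2 (grad F x) ^+ 2],
    and let [a] be the stepsize of iteration [k].

    With the current iterate [x] frozen, averaging the data replaces [f] by [F],
    and the descent lemma shows that the mean step is [- a *: grad F x + e],
    where [norm2 e] is of order [a ^+ 2]; the constant involves only the second
    and fourth moments of the directions ([direction_bias], [step_mean]). The
    variance assumption then bounds the second moment of the step by a constant
    multiple of [a ^+ 2], plus [a ^+ 2 * (M_V + 2) * G x]. The descent lemma for
    [F], in mean and with [a * L * (M_V + 2) <= 1], shows that [F] decreases by
    at least [a / 4 * G x] up to an error of order [a ^+ 2]. The descent lemma
    for [G] shows that [G] grows by at most a constant multiple of [a * G x], up
    to an error of the same order, because a nonnegative function with a
    Lipschitz gradient satisfies [norm2 (grad G x) ^+ 2 <= 2 * L_G * G x]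
    ([sqr_norm2_grad_le]). Both facts are [conditional_step].

    Total expectations come from Tonelli's theorem. The iterate depends only on
    the past seeds, the past and present seeds generate independent
    sigma-algebras ([independent_blocks]), and for two independent
    sigma-algebras the law of the diagonal map [w |-> (w, w)] is a product
    measure ([tonelli_independent]). This gives two recursions for the
    nonnegative numbers [E (F (x k)) - F_inf] and [E (G (x k))], whose
    finiteness follows by induction. The first recursion makes the series of
    [a * E (G (x k))] converge and the second makes [E (G (x k))] converge; since
    the stepsizes have an infinite sum, the limit is 0
    ([cvg0_two_sequences]). *)

(** * The Euclidean inner product and the descent lemma *)

Section euclidean_inner_product.
Context {R : realType} {d : nat}.
Implicit Types u v x : 'rV[R]_d.

(** The Euclidean inner product, whose square norm is [norm2 v ^+ 2]. *)
Definition inner u v : R := \sum_i u ord0 i * v ord0 i.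

Lemma norm2_ge0 v : 0 <= norm2 v.
Proof. exact: sqrtr_ge0. Qed.

Lemma sqr_norm2 v : norm2 v ^+ 2 = inner v v.
Proof.
rewrite /norm2 sqr_sqrtr; last by apply: sumr_ge0 => i _; exact: sqr_ge0.
by apply: eq_bigr => i _; rewrite expr2.
Qed.

Lemma innerC u v : inner u v = inner v u.
Proof. by apply: eq_bigr => i _; rewrite mulrC. Qed.

Lemma innerDl u u' v : inner (u + u') v = inner u v + inner u' v.
Proof. by rewrite -big_split; apply: eq_bigr => i _; rewrite mxE mulrDl. Qed.

Lemma innerDr u v v' : inner u (v + v') = inner u v + inner u v'.
Proof. by rewrite innerC innerDl !(innerC u). Qed.

Lemma innerZl a u v : inner (a *: u) v = a * inner u v.
Proof. by rewrite mulr_sumr; apply: eq_bigr => i _; rewrite mxE mulrA. Qed.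

Lemma innerZr a u v : inner u (a *: v) = a * inner u v.
Proof. by rewrite innerC innerZl innerC. Qed.

Lemma innerNl u v : inner (- u) v = - inner u v.
Proof. by rewrite -scaleN1r innerZl mulN1r. Qed.

Lemma innerNr u v : inner u (- v) = - inner u v.
Proof. by rewrite innerC innerNl innerC. Qed.

Lemma inner_ge0 u : 0 <= inner u u.
Proof. by rewrite -sqr_norm2 sqr_ge0. Qed.

Lemma norm2Z a u : norm2 (a *: u) = `|a| * norm2 u.
Proof.
apply/eqP; rewrite -(@eqrXn2 _ 2) ?mulr_ge0 ?norm2_ge0//.
by rewrite exprMn !sqr_norm2 innerZl innerZr mulrA real_normK ?num_real// expr2.
Qed.

Lemma norm2N u : norm2 (- u) = norm2 u.
Proof. by rewrite -scaleN1r norm2Z normrN1 mul1r. Qed.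

(** Young's inequality, with a weight [t]. *)
Lemma inner_young t u v : 0 < t ->
  inner u v <= (t * norm2 u ^+ 2 + norm2 v ^+ 2 / t) / 2.
Proof.
move=> t0; have := inner_ge0 (t *: u - v).
rewrite innerDl !innerDr !innerNl !innerNr !innerZl !innerZr (innerC v u).
rewrite !sqr_norm2 => h.
rewrite ler_pdivlMr// -subr_ge0 -(pmulr_rge0 _ t0).
suff -> : t * (t * inner u u + inner v v / t - inner u v * 2) =
  t * (t * inner u u) + - (t * inner u v) + (- (t * inner u v) + - - inner v v) by [].
by field; rewrite gt_eqF.
Qed.

Lemma inner_norm2_eq0 u v : norm2 u = 0 -> inner u v = 0.
Proof.
move=> u0; rewrite /inner big1// => i _.
have : inner u u = 0 by rewrite -sqr_norm2 u0 expr0n.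
move/eqP; rewrite psumr_eq0 => [|j _]; last by rewrite -expr2 sqr_ge0.
move=> /allP/(_ i (mem_index_enum _))/=.
by rewrite mulf_eq0 orbb => /eqP ->; rewrite mul0r.
Qed.

Lemma cauchy_schwarz u v : inner u v <= norm2 u * norm2 v.
Proof.
have [u0|u0] := eqVneq (norm2 u) 0; first by rewrite inner_norm2_eq0// u0 mul0r.
have [v0|v0] := eqVneq (norm2 v) 0.
  by rewrite innerC inner_norm2_eq0// v0 mulr0.
have u1 : 0 < norm2 u by rewrite lt0r u0 norm2_ge0.
have v1 : 0 < norm2 v by rewrite lt0r v0 norm2_ge0.
(* this weight makes both terms of Young's inequality equal *)
apply: le_trans (inner_young u v (divr_gt0 v1 u1)) _.
rewrite le_eqVlt; apply/orP; left; apply/eqP.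
by field; rewrite u0 v0.
Qed.

Lemma sqr_norm2D u v :
  norm2 (u + v) ^+ 2 <= 2 * norm2 u ^+ 2 + 2 * norm2 v ^+ 2.
Proof.
rewrite !sqr_norm2 innerDl !innerDr.
have := inner_young u v ltr01; rewrite !sqr_norm2 (innerC v u) divr1 mul1r; lra.
Qed.

Lemma le_sqr_norm2 v i : v ord0 i ^+ 2 <= norm2 v ^+ 2.
Proof.
rewrite sqr_norm2 /inner (bigD1 i)//= -expr2 lerDl.
by apply: sumr_ge0 => j _; rewrite -expr2 sqr_ge0.
Qed.

End euclidean_inner_product.

Section descent_lemma.
Context {R : realType} {d : nat}.
Implicit Types (F : 'rV[R]_d -> R) (x v : 'rV[R]_d).

Lemma derive_inner F x v : differentiable F x -> 'D_v F x = inner (grad F x) v.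
Proof.
move=> dF; rewrite deriveE// [in LHS](row_sum_delta v) linear_sum.
apply: eq_bigr => i _; rewrite linearZ mxE deriveE// mulrC//.
Qed.

Lemma derive_along_line F x v (t : R) : (forall y, differentiable F y) ->
  is_derive t 1 (fun s : R => F (x + s *: v)) (inner (grad F (x + t *: v)) v).
Proof.
move=> dF.
(* both derivatives are limits of the same difference quotient *)
have E : (fun h : R =>
      h^-1 *: ((F \o shift (x + t *: v)) (h *: v) - F (x + t *: v))) =
    (fun h : R =>
      h^-1 *: (((fun s : R => F (x + s *: v)) \o shift t) (h *: (1 : R))
               - F (x + t *: v))).
  apply/funext => h; congr (_ *: (F _ - _)) => /=.
  by rewrite addrCA -scalerDl /GRing.scale/= mulr1.
rewrite -derive_inner//.
have dv := @diff_derivable _ _ _ F (x + t *: v) v (dF _).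
split; first by move: dv; rewrite /derivable E.
by rewrite /derive E.
Qed.

(** The descent lemma. Along the segment from [x] to [x + v], the difference
    between [F] and its quadratic model has a nonpositive derivative, by the
    Cauchy-Schwarz inequality; the mean value theorem concludes. *)
Lemma descent_upper K F x v : (forall y, differentiable F y) ->
  lipschitz_grad K F ->
  F (x + v) <= F x + inner (grad F x) v + K / 2 * norm2 v ^+ 2.
Proof.
move=> dF lipF.
pose phi (t : R) := F (x + t *: v) -
  (t * inner (grad F x) v + t ^+ 2 * (K / 2 * norm2 v ^+ 2)).
pose dphi (t : R) := inner (grad F (x + t *: v)) v -
  (inner (grad F x) v + 2 * t * (K / 2 * norm2 v ^+ 2)).
have Dphi t : is_derive t (1 : R) phi (dphi t).
  have dl := derive_along_line x v t dF.
  pose q := (inner (grad F x) v)%:P * 'X + (K / 2 * norm2 v ^+ 2)%:P * 'X^2.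
  have dq := is_derive_poly q t.
  have -> : phi = (fun s : R => F (x + s *: v)) - horner q.
    apply/funext => s.
    by rewrite /phi /q !fctE !(hornerD,hornerM,hornerC,hornerX,hornerXn); ring.
  have -> : dphi t = inner (grad F (x + t *: v)) v - q^`().[t].
    rewrite /dphi /q derivD !mul_polyC !derivZ derivX derivXn.
    rewrite !(hornerD,hornerZ,hornerC,hornerX,hornerXn,hornerMn)/= expr1.
    ring.
  exact: is_deriveB.
have cphi : {within `[0, 1], continuous phi}.
  apply: continuous_subspaceT => s; apply: differentiable_continuous.
  by apply/derivable1_diffP; apply: ex_derive.
have [c] := MVT ltr01 (fun s _ => Dphi s) cphi.
rewrite in_itv/= => /andP[c0 c1].
rewrite /phi /dphi scale1r scale0r addr0.
have := cauchy_schwarz (grad F (x + c *: v) - grad F x) v.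
rewrite innerDl innerNl.
have := lipF x (x + c *: v).
rewrite [x + _]addrC addrK norm2Z (gtr0_norm c0) => /(ler_wpM2r (norm2_ge0 v)).
nra.
Qed.

Lemma gradN F x : (forall y, differentiable F y) ->
  grad (fun y => - F y) x = - grad F x.
Proof.
move=> dF; apply/rowP => i; rewrite !mxE; rewrite deriveN//.
exact: diff_derivable.
Qed.

Lemma lipschitz_gradN K F : (forall y, differentiable F y) ->
  lipschitz_grad K F -> lipschitz_grad K (fun y => - F y).
Proof.
move=> dF lipF x x'; rewrite !gradN// -opprD norm2N; exact: lipF.
Qed.

Lemma descent_abs K F x v : (forall y, differentiable F y) ->
  lipschitz_grad K F ->
  `|F (x + v) - F x - inner (grad F x) v| <= K / 2 * norm2 v ^+ 2.
Proof.
move=> dF lipF; rewrite ler_norml; apply/andP; split; last first.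
  by have := descent_upper x v dF lipF; lra.
have dN y : differentiable (fun y => - F y) y by exact: differentiableN.
have := descent_upper x v dN (lipschitz_gradN dF lipF).
by rewrite gradN// innerNl; lra.
Qed.

(** A nonnegative function with a Lipschitz gradient controls the square of
    its gradient: apply the descent lemma to a gradient step of length
    [1 / K], where the function is still nonnegative. *)
Lemma sqr_norm2_grad_le K F x : 0 < K -> (forall y, differentiable F y) ->
  lipschitz_grad K F -> (forall y, 0 <= F y) ->
  norm2 (grad F x) ^+ 2 <= 2 * K * F x.
Proof.
move=> K0 dF lipF F0.
have := descent_upper x (- K^-1 *: grad F x) dF lipF.
move/(le_trans (F0 _)).
rewrite innerZr norm2Z exprMn -sqr_norm2 normrN (gtr0_norm) ?invr_gt0//.
set g := norm2 _ ^+ 2.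
have -> : F x + - K^-1 * g + K / 2 * (K^-1 ^+ 2 * g) = F x - g / (2 * K).
  by field; rewrite gt_eqF.
by rewrite subr_ge0 ler_pdivrMr ?mulr_gt0// mulrC.
Qed.

End descent_lemma.

(** * Convergence of two coupled recursions *)

Section two_sequences.
Context {R : realType}.

(** If [a] decreases by at least [c * alpha * g] up to an error of order
    [alpha ^+ 2], and [g] grows by at most a multiple of [alpha * g] up to an
    error of the same order, then [g] tends to 0. The sequence
    [t k = beta ^+ 2 / (k + sigma)] satisfies [alpha k ^+ 2 <= t k - t k.+1], so
    [a + B * t] and [g + (C / c) * (a + B * t) + D * t] are nonincreasing and
    nonnegative. Hence [g] converges, and its limit is 0 because the series of
    [alpha] diverges while that of [alpha * g] converges. *)
Lemma cvg0_two_sequences (beta sigma c B C D : R) (a g : nat -> R) :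
  0 < beta -> 0 < sigma -> 0 < c -> 0 <= B -> 0 <= C -> 0 <= D ->
  (forall k, 0 <= a k) -> (forall k, 0 <= g k) ->
  (forall k, a k.+1 + c * stepsize beta sigma k * g k
             <= a k + B * stepsize beta sigma k ^+ 2) ->
  (forall k, g k.+1 <= g k + C * stepsize beta sigma k * g k
             + D * stepsize beta sigma k ^+ 2) ->
  g k @[k --> \oo] --> 0.
Proof.
move=> beta0 sigma0 c0 B0 C0 D0 a0 g0 ha hg.
pose al := stepsize beta sigma.
have al0 k : 0 < al k by rewrite /al/stepsize divr_gt0// ltr_pwDr// ler0n.
pose t k : R := beta ^+ 2 / (k%:R + sigma).
have ks0 k : 0 < k%:R + sigma :> R by rewrite ltr_pwDr// ler0n.
have t0 k : 0 <= t k by rewrite /t divr_ge0 ?sqr_ge0// ltW.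
have tal k : al k ^+ 2 + t k.+1 <= t k.
  rewrite /al /stepsize /t exprMn.
  have := ks0 k; rewrite -(natr1 k); set s := k%:R + sigma => s0.
  have -> : k%:R + 1 + sigma = s + 1 by rewrite /s; ring.
  have s10 : 0 < s + 1 by rewrite ltr_wpDl// ltW.
  rewrite -mulrDr ler_wpM2l ?sqr_ge0// -subr_ge0.
  have -> : s^-1 - ((s + 1)^-1 ^+ 2 + (s + 1)^-1) = s^-1 * (s + 1)^-1 ^+ 2.
    by field; rewrite !gt_eqF.
  by rewrite mulr_ge0 ?sqr_ge0// invr_ge0 ltW.
have noninc (u : nat -> R) :
  (forall k, u k.+1 <= u k) -> (forall k, 0 <= u k) -> cvgn u.
  move=> h h0; apply: nonincreasing_is_cvgn.
    apply/nonincreasing_seqP => k.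
    exact: h.
  by exists 0 => _ [k _ <-].
have ct : cvgn t.
  apply: noninc => // k; apply: le_trans (tal k).
  by rewrite lerDr sqr_ge0.
(* a multiple of [t] absorbs the error terms *)
pose u k := a k + B * t k.
have hu k : u k.+1 + c * (al k * g k) <= u k.
  rewrite /u; have := ha k; have := ler_wpM2l B0 (tal k); rewrite -/(al k); lra.
have cu : cvgn u.
  apply: noninc => k; last by rewrite addr_ge0// mulr_ge0.
  apply: le_trans (hu k).
  by rewrite lerDl mulr_ge0 ?(ltW c0)// mulr_ge0 ?(ltW (al0 k)).
pose v k := g k + C / c * u k + D * t k.
have cv : cvgn v.
  apply: noninc => k; last first.
    rewrite !addr_ge0// mulr_ge0// ?divr_ge0// ?(ltW c0)//.
    by rewrite addr_ge0// mulr_ge0.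
  rewrite /v; have := hg k; have := ler_wpM2l D0 (tal k).
  have := ler_wpM2l (divr_ge0 C0 (ltW c0)) (hu k); rewrite -/(al k) mulrDr.
  have -> : C / c * (c * (al k * g k)) = C * al k * g k by field; rewrite gt_eqF.
  lra.
have cg : cvgn g.
  have -> : g = (fun k => v k - C / c * u k - D * t k).
    by apply/funext => k; rewrite /v; ring.
  by apply: is_cvgB; [apply: is_cvgB => //|]; apply: is_cvgMr.
set l := limn g.
have l0 : 0 <= l by apply: limr_ge => //; apply: nearW.
suff -> : 0 = l by [].
apply/eqP; rewrite eq_le l0 leNgt; apply/negP => lpos.
(* a positive limit would bound the partial sums of the harmonic series *)
have := @dvg_harmonic R; apply.
have : \forall k \near \oo, l / 2 <= g k.
  move: cg => /cvgrPdist_lt/(_ (l/2)); rewrite divr_gt0// => /(_ isT).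
  by apply: filterS => k; rewrite -/l ltr_norml => /andP[_]; lra.
case=> N _ hN.
pose e := c * (beta / (1 + sigma)) * (l / 2).
have e0 : 0 < e by rewrite /e !mulr_gt0// ?invr_gt0// addr_gt0.
have alh k : beta / (1 + sigma) * harmonic k <= al k.
  rewrite /al /stepsize -mulrA ler_wpM2l ?(ltW beta0)//= -invfM.
  rewrite lef_pV2 ?posrE ?mulr_gt0 ?addr_gt0// ?ltr0n// mulrDl mul1r lerD2l.
  by rewrite ler_peMr ?(ltW sigma0)// ler1n.
have sb k : u (N + k)%N +
    e * (series (@harmonic R) (N + k)%N - series harmonic N) <= u N.
  elim: k => [|k IH]; first by rewrite addn0 subrr mulr0 addr0.
  rewrite addnS seriesSr; apply: le_trans IH.
  apply: le_trans (lerD (hu (N + k)%N) (lexx _)).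
  have : e * harmonic (N + k)%N <= c * (al (N + k)%N * g (N + k)%N).
    have -> : e * harmonic (N + k)%N =
        c * (beta / (1 + sigma) * harmonic (N + k)%N * (l / 2)) by rewrite /e; ring.
    rewrite ler_pM2l// ler_pM//.
    - by rewrite mulr_ge0 ?harmonic_ge0// ltW// divr_gt0// addr_gt0.
    - by rewrite ltW// divr_gt0.
    - by apply: hN; exact: leq_addr.
  lra.
apply: nondecreasing_is_cvgn.
  by apply/nondecreasing_seqP => k; rewrite seriesSr lerDl harmonic_ge0.
exists (series harmonic N + u N / e) => _ [k _ <-].
have u0 k' : 0 <= u k' by rewrite addr_ge0// mulr_ge0.
have := sb k; have := u0 (N + k)%N => h1 h2.
have : series (@harmonic R) k <= series harmonic (N + k)%N.
  rewrite addnC -subr_ge0 sub_series_geq ?leq_addr//.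
  by apply: sumr_ge0 => i _; exact: harmonic_ge0.
have : series (@harmonic R) (N + k)%N - series harmonic N <= u N / e.
  by rewrite ler_pdivlMr// mulrC; lra.
lra.
Qed.

End two_sequences.

(** * Independent sigma-algebras and Fubini's theorem *)

Section independent_sigma_algebras.
Context {dO : measure_display} {Omega : measurableType dO} {R : realType}.
Variable Q : probability Omega R.
Implicit Types G H : set (set Omega).

(** Every event of [G] is independent of every event of [H]. *)
Definition independent_systems G H : Prop :=
  forall A B, G A -> H B -> Q (A `&` B) = (Q A * Q B)%E.

Lemma sub_sigma_measurable G : G `<=` measurable -> <<s G >> `<=` measurable.
Proof. by move=> Gm; apply: smallest_sub => //; exact: sigma_algebra_measurable. Qed.

Lemma independent_systemsC G H : independent_systems G H -> independent_systems H G.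
Proof. by move=> GH A B HA GB; rewrite setIC muleC GH. Qed.

(** Half of the pi-lambda argument: for a fixed [B] in [H], the finite measures
    [A |-> Q (A `&` B)] and [A |-> Q A * Q B] agree on the pi-system [G]. *)
Lemma independent_sigma_left G H : G `<=` measurable -> H `<=` measurable ->
  setI_closed G ->
  independent_systems G H -> independent_systems <<s G >> H.
Proof.
move=> Gm Hm GI GH A B GA HB.
have mB := Hm _ HB.
have QBfin : Q B \is a fin_num by exact: fin_num_measure.
have QB0 : (0 <= fine (Q B))%R by apply: fine_ge0.
pose m1 : {measure set Omega -> \bar R} := mrestr Q mB.
pose m2 : {measure set Omega -> \bar R} := mscale (NngNum QB0) Q.
suff : m1 A = m2 A by rewrite /m1/m2/= /mrestr/= /mscale/= fineK// muleC.
(* the full set is added because uniqueness needs a cover of the space *)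
pose G' := G `|` [set setT].
have G'I : setI_closed G'.
  move=> X Y [GX|->] [GY|->]; rewrite ?setTI ?setIT; [|by left..|by right].
  by left; exact: GI.
apply: (g_sigma_algebra_measure_unique G' _ (fun=> setT)).
- by move=> X [/Gm//|->].
- by move=> _; right.
- by rewrite bigcup_const//.
- exact: G'I.
- move=> X [GX|->]; rewrite /m1/m2/= /mrestr/= /mscale/= fineK//.
    by rewrite GH// muleC.
  by rewrite setTI probability_setT mule1.
- move=> _; rewrite /m1/= /mrestr/= setTI; apply: le_lt_trans (ltry 1).
  exact: probability_le1.
- by move: A GA; apply: sub_sigma_algebra2; exact: subsetUl.
Qed.

Lemma independent_sigma G H : G `<=` measurable -> H `<=` measurable ->
  setI_closed G -> setI_closed H ->
  independent_systems G H -> independent_systems <<s G >> <<s H >>.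
Proof.
move=> Gm Hm GI HI GH.
apply: independent_sigma_left => //; first exact: sub_sigma_measurable.
apply: independent_systemsC; apply: independent_sigma_left => //.
exact: independent_systemsC.
Qed.

End independent_sigma_algebras.

Section restricted_measure.
Context {dO : measure_display} {Omega : measurableType dO} {R : realType}.
Variable Q : probability Omega R.
Variable G : set (set Omega).
Hypothesis Gm : G `<=` measurable.

Lemma measurable_fun_sub d (T : measurableType d) (f : Omega -> T) :
  measurable_fun [set: g_sigma_algebraType G] (f : g_sigma_algebraType G -> T) ->
  measurable_fun setT f.
Proof.
move=> mf _ A mA; rewrite setTI.
by apply: (sub_sigma_measurable Gm); rewrite -[X in _ X]setTI; exact: mf.
Qed.

Lemma measurable_idG : measurable_fun setT (idfun : Omega -> g_sigma_algebraType G).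
Proof. apply: measurable_fun_sub; exact: measurable_id. Qed.

(** The identity, as a random variable with values in the same set equipped
    with the coarser sigma-algebra generated by [G]; its law is the
    restriction of [Q] to that sigma-algebra. *)
Definition rv_idG : {RV Q >-> g_sigma_algebraType G} :=
  HB.pack (idfun : Omega -> g_sigma_algebraType G)
    (isMeasurableFun.Build _ _ _ _ _ measurable_idG).

Definition restrictQ : probability (g_sigma_algebraType G) R :=
  distribution Q rv_idG.

End restricted_measure.

Section fubini_independent.
Local Open Scope ereal_scope.
Context {dO : measure_display} {Omega : measurableType dO} {R : realType}.
Variable Q : probability Omega R.
Variables G1 G2 : set (set Omega).
Hypothesis G1m : G1 `<=` measurable.
Hypothesis G2m : G2 `<=` measurable.
Hypothesis indep : independent_systems Q <<s G1 >> <<s G2 >>.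

Local Notation O1 := (g_sigma_algebraType G1).
Local Notation O2 := (g_sigma_algebraType G2).

Let diag (w : Omega) : O1 * O2 := (w, w).

Let mdiag : measurable_fun setT diag.
Proof.
apply: measurable_fun_pair.
- exact: measurable_idG.
- exact: measurable_idG.
Qed.

Let diagRV : {RV Q >-> (O1 * O2)%type} :=
  HB.pack diag (isMeasurableFun.Build _ _ _ _ _ mdiag).

(* independence says exactly that the diagonal has the product law *)
Let diag_law (X : set (O1 * O2)) : measurable X ->
  (restrictQ Q G1m \x restrictQ Q G2m) X = distribution Q diagRV X.
Proof.
apply: product_measure_unique => A B mA mB.
rewrite /= /distribution /pushforward/=.
rewrite -[RHS]/(Q A * Q B) -indep//.
Qed.

(** Two copies of [Omega] carry the independent sigma-algebras. Freezing the
    first argument and averaging over the second is the conditional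
    expectation given the first sigma-algebra. *)
Lemma tonelli_independent (h : O1 * O2 -> \bar R) :
  measurable_fun [set: O1 * O2] h -> (forall z, 0 <= h z) ->
  \int[Q]_w h (w, w) = \int[Q]_w \int[Q]_w' h (w, w').
Proof.
move=> mh h0.
transitivity (\int[distribution Q diagRV]_z h z).
  by rewrite ge0_integral_distribution.
transitivity (\int[restrictQ Q G1m \x restrictQ Q G2m]_z h z).
  by apply: eq_measure_integral => A mA _; exact/esym/diag_law.
rewrite fubini_tonelli1//.
rewrite /fubini_F ge0_integral_distribution//=; last 2 first.
- exact: measurable_fun_fubini_tonelli_F.
- by move=> w; apply: integral_ge0 => w' _.
apply: eq_integral => w _ /=.
rewrite ge0_integral_distribution//.
exact: measurable_fun_pair2.
Qed.

Lemma measurable_partial_integral (h : O1 * O2 -> \bar R) :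
  measurable_fun [set: O1 * O2] h -> (forall z, 0 <= h z) ->
  measurable_fun setT (fun w : Omega => \int[Q]_w' h (w, w')).
Proof.
move=> mh h0; apply: (measurable_fun_sub G1m).
rewrite (_ : (fun w : O1 => _) = (fun w => \int[restrictQ Q G2m]_w' h (w, w'))).
  exact: measurable_fun_fubini_tonelli_F.
apply/funext => w; rewrite ge0_integral_distribution//.
exact: measurable_fun_pair2.
Qed.

Lemma fubini_independent (h : O1 * O2 -> \bar R) :
  measurable_fun [set: O1 * O2] h -> Q.-integrable setT (fun w => h (w, w)) ->
  (forall w, Q.-integrable setT (fun w' => h (w, w'))) ->
  \int[Q]_w h (w, w) = \int[Q]_w \int[Q]_w' h (w, w').
Proof.
move=> mh ih ih2.
have idist : (distribution Q diagRV).-integrable setT h.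
  by apply: integrable_pushforward => //; rewrite preimage_setT.
transitivity (\int[distribution Q diagRV]_z h z).
  by rewrite integral_distribution.
transitivity (\int[restrictQ Q G1m \x restrictQ Q G2m]_z h z).
  by apply: eq_measure_integral => A mA _; exact/esym/diag_law.
have iprod : (restrictQ Q G1m \x restrictQ Q G2m).-integrable setT h.
  apply/integrableP; split => //.
  rewrite (eq_measure_integral (distribution Q diagRV)).
    by case/integrableP: idist.
  by move=> A mA _; exact: diag_law.
rewrite -integral12_prod_meas1//.
have hE w : \int[restrictQ Q G2m]_w' h (w, w') = \int[Q]_w' h (w, w').
  rewrite integral_distribution//; last exact: ih2.
  exact: measurable_fun_pair2.
have mF := measurable_fubini_F iprod.
have iF := integrable_fubini_F iprod.
rewrite (integral_distribution mF); last first.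
  apply/integrableP; split; first exact: (measurable_fun_sub G1m).
  case/integrableP: iF => _; rewrite ge0_integral_distribution//.
  exact: measurableT_comp.
by apply: eq_integral => w _; exact: hE.
Qed.

End fubini_independent.

(** * Disjoint blocks of a mutually independent family *)

Section independent_blocks.
Context {dO : measure_display} {Omega : measurableType dO} {R : realType}.
Variables (Q : probability Omega R) (I : choiceType) (D : set I)
  (S : I -> set (set Omega)).
Hypothesis Sm : forall i, S i `<=` measurable.
Hypothesis ST : forall i, S i setT.
Hypothesis SI : forall i, setI_closed (S i).
Hypothesis indep : mutually_independent Q D S.

(** Finite intersections of events of the families indexed by [B]. The events
    outside the finite index set are irrelevant, and are chosen in their
    families so that no side condition is needed. *)
Definition rectangles (B : set I) : set (set Omega) :=
  [set A | exists (J : {fset I}) (E : I -> set Omega),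
    [/\ [set` J] `<=` B, forall i, S i (E i) &
        A = \bigcap_(i in [set` J]) E i]].

Lemma rectangles_measurable B : rectangles B `<=` measurable.
Proof.
move=> A [J [E [_ SE ->]]].
by apply: fin_bigcap_measurable => // i _; exact: (Sm (SE i)).
Qed.

Lemma rectangles_setI B : setI_closed (rectangles B).
Proof.
move=> A A' [J [E [JB SE ->]]] [J' [E' [J'B SE' ->]]].
pose T i := (if i \in J then E i else setT) `&`
            (if i \in J' then E' i else setT).
exists (J `|` J')%fset, T; split.
- by move=> i /=; rewrite in_fsetU => /orP[/JB|/J'B].
- by move=> i; apply: SI; case: ifP.
- apply/seteqP; split => [w [wE wE'] i /= _|w wT].
    by rewrite /T; split; case: ifP => // ?; [exact: wE|exact: wE'].
  split=> i /= iJ; have := wT i; rewrite /= in_fsetU iJ ?orbT/= /T iJ => /(_ isT).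
    by case.
  by case.
Qed.

Lemma sub_rectangles B : \bigcup_(i in B) S i `<=` rectangles B.
Proof.
move=> A [i Bi SA]; exists [fset i]%fset, (fun j => if j == i then A else setT).
split.
- by move=> j /=; rewrite inE => /eqP ->.
- by move=> j; case: eqP => [->//|_].
- by rewrite set_fset1 bigcap_set1 eqxx.
Qed.

Lemma independent_rectangles B B' : B `<=` D -> B' `<=` D -> B `&` B' = set0 ->
  independent_systems Q (rectangles B) (rectangles B').
Proof.
move=> BD B'D BB' A A' [J [E [JB SE ->]]] [J' [E' [J'B SE' ->]]].
have JJ' i : i \in J -> i \in J' -> False.
  by move=> /JB Bi /J'B B'i; have : (B `&` B') i by []; rewrite BB'.
pose T i := if i \in J then E i else E' i.
have ST' i : S i (T i) by rewrite /T; case: ifP.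
have TE : \bigcap_(i in [set` J]) E i = \bigcap_(i in [set` J]) T i.
  by apply: eq_bigcapr => i /= iJ; rewrite /T iJ.
have TE' : \bigcap_(i in [set` J']) E' i = \bigcap_(i in [set` J']) T i.
  apply: eq_bigcapr => i /= iJ'; rewrite /T; case: ifP => // iJ.
  by have := JJ' _ iJ iJ'.
rewrite TE TE' -bigcap_setU.
have -> : [set` J] `|` [set` J'] = [set` (J `|` J')%fset].
  by apply/seteqP; split=> i /=; rewrite in_fsetU => /orP.
rewrite !indep//.
- rewrite [LHS](perm_big (enum_fset J ++ enum_fset J')) ?big_cat//=.
  apply: uniq_perm; first exact: fset_uniq.
    rewrite cat_uniq !fset_uniq andbT/=; apply/hasPn => i iJ'.
    by apply/negP => iJ; exact: (JJ' i).
  by move=> i; rewrite mem_cat in_fsetU.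
- by move=> i /J'B/B'D.
- by move=> i /JB/BD.
- by move=> i /=; rewrite in_fsetU => /orP[/JB/BD|/J'B/B'D].
Qed.

(** Disjoint blocks of a mutually independent family of sigma-algebras generate
    independent sigma-algebras. *)
Lemma independent_blocks B B' : B `<=` D -> B' `<=` D -> B `&` B' = set0 ->
  independent_systems Q <<s \bigcup_(i in B) S i >> <<s \bigcup_(i in B') S i >>.
Proof.
move=> BD B'D BB'.
have h := independent_sigma (@rectangles_measurable B)
  (@rectangles_measurable B') (@rectangles_setI B) (@rectangles_setI B')
  (independent_rectangles BD B'D BB').
move=> A A' hA hA'; apply: h.
  by apply: sub_sigma_algebra2 hA; exact: sub_rectangles.
by apply: sub_sigma_algebra2 hA'; exact: sub_rectangles.
Qed.

End independent_blocks.

(** * Measurability of row vectors, gradients and steps *)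

Section measurable_row_vectors.
Context {R : realType} {d : nat}.

Lemma measurable_coord (i : 'I_d) :
  measurable_fun setT (fun v : 'rV[R]_d => v ord0 i).
Proof.
move=> _ A mA; apply: sub_sigma_algebra.
rewrite -bigcup_seq; exists i; first by rewrite /= mem_index_enum.
by exists A.
Qed.

Lemma measurable_rowP dT (T : measurableType dT) (g : T -> 'rV[R]_d) :
  (forall i, measurable_fun setT (fun w => g w ord0 i)) -> measurable_fun setT g.
Proof.
move=> mg; pose coord (i : 'I_d) (v : 'rV[R]_d) := v ord0 i.
pose G := \big[setU/set0]_(i < d) preimage_set_system setT (coord i) measurable.
apply: (@measurability _ _ _ _ _ _ G) => // _ [A GA <-].
move: GA; rewrite /G -bigcup_seq => -[i _ [B mB <-]].
rewrite !setTI.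
by rewrite -[X in measurable X]setTI; exact: mg.
Qed.

Lemma measurable_row_comp dT (T : measurableType dT) (g : T -> 'rV[R]_d) i :
  measurable_fun setT g -> measurable_fun setT (fun w => g w ord0 i).
Proof. by move=> mg; apply: (measurableT_comp (measurable_coord i)). Qed.

Lemma measurable_rowD dT (T : measurableType dT) (g h : T -> 'rV[R]_d) :
  measurable_fun setT g -> measurable_fun setT h ->
  measurable_fun setT (fun w => g w + h w).
Proof.
move=> mg mh; apply: measurable_rowP => i.
under eq_fun do rewrite mxE.
by apply: measurable_funD; exact: measurable_row_comp.
Qed.

Lemma measurable_rowZ dT (T : measurableType dT) (a : T -> R) (g : T -> 'rV[R]_d) :
  measurable_fun setT a -> measurable_fun setT g ->
  measurable_fun setT (fun w => a w *: g w).
Proof.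
move=> ma mg; apply: measurable_rowP => i.
under eq_fun do rewrite mxE.
by apply: measurable_funM => //; exact: measurable_row_comp.
Qed.

Lemma measurable_row_sum dT (T : measurableType dT) m (g : 'I_m -> T -> 'rV[R]_d) :
  (forall k, measurable_fun setT (g k)) ->
  measurable_fun setT (fun w => \sum_k g k w).
Proof.
move=> mg; apply: measurable_rowP => i.
under eq_fun do rewrite summxE.
by apply: measurable_sum => k; exact: measurable_row_comp.
Qed.

Lemma measurable_sqr_norm2 dT (T : measurableType dT) (g : T -> 'rV[R]_d) :
  measurable_fun setT g -> measurable_fun setT (fun w => norm2 (g w) ^+ 2).
Proof.
move=> mg; under eq_fun do rewrite sqr_norm2.
by apply: measurable_sum => k; apply: measurable_funM; exact: measurable_row_comp.
Qed.

End measurable_row_vectors.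

Section measurable_gradient.
Context {R : realType} {d : nat}.

Lemma measurable_parametric_mean dX (Xi : measurableType dX)
    (P : probability Xi R) (f : 'rV[R]_d -> Xi -> R) (F : 'rV[R]_d -> R) :
  measurable_fun [set: 'rV[R]_d * Xi] (fun p => f p.1 p.2) ->
  (forall u, (F u)%:E = 'E_P[f u]%E) ->
  measurable_fun setT F.
Proof.
move=> mf Fdef; apply/measurable_EFinP.
pose h (p : 'rV[R]_d * Xi) := (f p.1 p.2)%:E.
have mh : measurable_fun [set: 'rV[R]_d * Xi] h by exact/measurable_EFinP.
rewrite (_ : EFin \o F =
    (fun u => \int[P]_z (h^\+ (u, z)) - \int[P]_z (h^\- (u, z)))%E).
  apply: emeasurable_funB; apply: measurable_fun_fubini_tonelli_F => //.
    exact: measurable_funepos.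
  exact: measurable_funeneg.
apply/funext => u; rewrite /= Fdef unlock integralE; congr (_ - _)%E;
  by apply: eq_integral => z _; rewrite ?funeposE ?funenegE.
Qed.

Lemma cvg_difference_quotient (F : 'rV[R]_d -> R) x v : derivable F x v ->
  (k.+1%:R * (F (x + k.+1%:R^-1 *: v) - F x)) @[k --> \oo] --> 'D_v F x.
Proof.
move=> dF.
have h0 : k.+1%:R^-1 @[k --> \oo] --> (0 : R)^'.
  move=> A [e /= e0 eA].
  have := @cvg_harmonic R; move/cvgrPdist_lt/(_ _ e0); apply: filterS => k /= hk.
  by apply: eA => //=; rewrite gt_eqF// invr_gt0.
have := cvg_comp _ _ h0 dF.
rewrite (_ : _ \o _ =
  (fun k : nat => k.+1%:R * (F (x + k.+1%:R^-1 *: v) - F x)))//.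
by apply/funext => k /=; rewrite invrK [x + _]addrC.
Qed.

(** The partial derivatives are pointwise limits of difference quotients. *)
Lemma measurable_grad (F : 'rV[R]_d -> R) : measurable_fun setT F ->
  (forall x, differentiable F x) -> measurable_fun setT (grad F).
Proof.
move=> mF dF; apply: measurable_rowP => i.
under eq_fun do rewrite mxE.
pose h (k : nat) x :=
  k.+1%:R * (F (x + k.+1%:R^-1 *: delta_mx ord0 i) - F x).
have mh k : measurable_fun setT (h k).
  apply: measurable_funM => //; apply: measurable_funB => //.
  apply: measurableT_comp => //; exact: measurable_rowD.
have ch x : setT x -> h ^~ x @ \oo --> 'D_(delta_mx ord0 i) F x.
  by move=> _; apply: cvg_difference_quotient; exact: diff_derivable.
exact: (measurable_fun_cvg mh ch).
Qed.

End measurable_gradient.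

Section step_expression.
Context {R : realType} {d : nat} {Xi : Type}.
Variable f : 'rV[R]_d -> Xi -> R.

(** The four schemes have one common form: an average over the directions,
    each weighted by an average over its data samples. *)
Lemma sgfd_stepE c n q xi zeta a x : (0 < n)%N -> (0 < q)%N ->
  sgfd_step f c n q xi zeta a x =
  (outer_size c n q)%:R^-1 *: \sum_(i < outer_size c n q)
    ((inner_size c n q)%:R^-1 * \sum_(j < inner_size c n q)
       (f x (xi i j) - f (x + a *: zeta i) (xi i j))) *: zeta i.
Proof.
move=> n0 q0; case: c => /=.
- by rewrite !big_ord1 !invr1 mul1r scale1r.
- by rewrite big_ord1 invr1 scale1r -scaler_suml scalerA.
- by [].
- by congr (_ *: _); apply: eq_bigr => i _; rewrite big_ord1 invr1 mul1r.
Qed.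

End step_expression.

Lemma measurable_sgfd_step {R : realType} {d : nat} dX (Xi : measurableType dX)
    (f : 'rV[R]_d -> Xi -> R) dT (T : measurableType dT) c n q
    (xi : nat -> nat -> T -> Xi) (zeta : nat -> T -> 'rV[R]_d) a
    (X : T -> 'rV[R]_d) :
  (0 < n)%N -> (0 < q)%N ->
  measurable_fun [set: 'rV[R]_d * Xi] (fun p => f p.1 p.2) ->
  (forall i j, (i < outer_size c n q)%N -> (j < inner_size c n q)%N ->
     measurable_fun setT (xi i j)) ->
  (forall i, (i < outer_size c n q)%N -> measurable_fun setT (zeta i)) ->
  measurable_fun setT X ->
  measurable_fun setT (fun w =>
    sgfd_step f c n q (fun i j => xi i j w) (fun i => zeta i w) a (X w)).
Proof.
move=> n0 q0 mf mxi mzeta mX.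
under eq_fun do rewrite sgfd_stepE//.
apply: measurable_rowZ => //; apply: measurable_row_sum => i.
have mz : measurable_fun setT (zeta i) by exact: mzeta.
apply: measurable_rowZ => //; apply: measurable_funM => //.
apply: measurable_sum => j.
have mx : measurable_fun setT (xi i j) by exact: mxi.
apply: measurable_funB.
  exact: (measurableT_comp mf (measurable_fun_pair mX mx)).
apply: (measurableT_comp mf (measurable_fun_pair _ mx)).
by apply: measurable_rowD => //; exact: measurable_rowZ.
Qed.

(** * Means, and the descent lemma in mean *)

Section has_mean.
Context {dO : measure_display} {Omega : measurableType dO} {R : realType}.
Variable Q : probability Omega R.
Implicit Types (X Y : Omega -> R) (m : R).

(** [X] is integrable with mean [m]. *)
Definition has_mean X m : Prop :=
  Q.-integrable setT (EFin \o X) /\ (\int[Q]_w (X w)%:E = m%:E)%E.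

Lemma has_mean_integrable X : Q.-integrable setT (EFin \o X) ->
  has_mean X (fine ('E_Q[X]))%E.
Proof.
move=> iX; split=> //; rewrite unlock fineK//.
exact: integrable_fin_num.
Qed.

Lemma has_mean_expectation X m : has_mean X m -> fine ('E_Q[X])%E = m.
Proof. by case=> _; rewrite unlock => ->. Qed.

Lemma has_mean_measurable X m : has_mean X m -> measurable_fun setT X.
Proof. by move=> [iX _]; apply/measurable_EFinP; exact: measurable_int iX. Qed.

Lemma has_mean_cst (c : R) : has_mean (fun=> c) c.
Proof.
split; first exact: finite_measure_integrable_cst.
by rewrite integral_cst//= probability_setT mule1.
Qed.

Lemma has_meanD X Y m m' : has_mean X m -> has_mean Y m' ->
  has_mean (fun w => X w + Y w) (m + m').
Proof.
move=> [iX EX] [iY EY]; split.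
  by have := integrableD measurableT iX iY; apply: eq_integrable.
under eq_integral do rewrite EFinD.
by rewrite integralD// EX EY.
Qed.

Lemma has_meanZ X m (c : R) : has_mean X m -> has_mean (fun w => c * X w) (c * m).
Proof.
move=> [iX EX]; split.
  by have := integrableZl measurableT c iX; apply: eq_integrable.
under eq_integral do rewrite EFinM.
by rewrite integralZl// EX.
Qed.

Lemma has_mean_sum (I : Type) (s : seq I) (X : I -> Omega -> R) (m : I -> R) :
  (forall i, has_mean (X i) (m i)) ->
  has_mean (fun w => \sum_(i <- s) X i w) (\sum_(i <- s) m i).
Proof.
move=> h; elim: s => [|i s IH].
  rewrite big_nil; under [X in has_mean X]eq_fun do rewrite big_nil.
  exact: has_mean_cst.
rewrite big_cons; under [X in has_mean X]eq_fun do rewrite big_cons.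
exact: has_meanD.
Qed.

Lemma has_mean_le X Y m m' : has_mean X m -> has_mean Y m' ->
  (forall w, X w <= Y w) -> m <= m'.
Proof.
move=> [iX EX] [iY EY] XY; rewrite -lee_fin -EX -EY.
by apply: le_integral => // w _; rewrite lee_fin.
Qed.

Lemma has_mean_dominated X Y m : measurable_fun setT X ->
  (forall w, `|X w| <= Y w) -> has_mean Y m ->
  exists2 m', has_mean X m' & `|m'| <= m.
Proof.
move=> mX XY [iY EY].
have iX : Q.-integrable setT (EFin \o X).
  apply: (le_integrable _ _ _ iY) => //; first exact/measurable_EFinP.
  by move=> w _ /=; rewrite lee_fin (le_trans (XY w))// ler_norm.
exists (fine 'E_Q[X])%E; first exact: has_mean_integrable.
have hX := has_mean_integrable iX.
rewrite ler_norml; apply/andP; split.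
  rewrite lerNl -mulN1r.
  apply: (has_mean_le (has_meanZ (-1) hX) (conj iY EY)) => w.
  by rewrite mulN1r (le_trans _ (XY w))// -normrN ler_norm.
apply: (has_mean_le hX (conj iY EY)) => w.
by rewrite (le_trans _ (XY w))// ler_norm.
Qed.

Lemma has_mean_ge0 X (b : R) : measurable_fun setT X -> (forall w, 0 <= X w) ->
  (\int[Q]_w (X w)%:E <= b%:E)%E -> exists2 m, has_mean X m & m <= b.
Proof.
move=> mX X0 Xb.
have iX : Q.-integrable setT (EFin \o X).
  apply/integrableP; split; first exact/measurable_EFinP.
  apply: le_lt_trans (ltry b); rewrite (le_trans _ Xb)//.
  rewrite le_eqVlt; apply/orP; left; apply/eqP.
  by apply: eq_integral => w _ /=; rewrite ger0_norm.
exists (fine 'E_Q[X])%E; first exact: has_mean_integrable.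
by have [_ E] := has_mean_integrable iX; rewrite -lee_fin -E.
Qed.

Lemma has_mean_ext X Y m : (forall w, X w = Y w) -> has_mean X m -> has_mean Y m.
Proof. by move=> XY; rewrite (_ : X = Y)//; exact/funext. Qed.

Lemma has_mean_inner {d : nat} (S : Omega -> 'rV[R]_d) (mu p : 'rV[R]_d) :
  (forall i, has_mean (fun w => S w ord0 i) (mu ord0 i)) ->
  has_mean (fun w => inner p (S w)) (inner p mu).
Proof. by move=> h; apply: has_mean_sum => i; exact: has_meanZ. Qed.

(** A finite variance makes the vector square-integrable, hence integrable,
    and bounds its second moment. *)
Lemma vector_variance_moments {d : nat} (S : Omega -> 'rV[R]_d) (v : R) :
  measurable_fun setT S -> (vector_variance Q S <= v%:E)%E ->
  (forall i, has_mean (fun w => S w ord0 i) (expected_vector Q S ord0 i)) /\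
  exists2 s, has_mean (fun w => norm2 (S w) ^+ 2) s &
    s <= v + norm2 (expected_vector Q S) ^+ 2.
Proof.
move=> mS; rewrite /vector_variance leeBlDr// -EFinD => Sv.
have mS2 := measurable_sqr_norm2 mS.
have [s hs sv] : exists2 s, has_mean (fun w => norm2 (S w) ^+ 2) s &
    s <= v + norm2 (expected_vector Q S) ^+ 2.
  apply: has_mean_ge0 => //; first by move=> w; exact: sqr_ge0.
  by rewrite unlock in Sv.
split; last by exists s.
move=> i.
have h1 := has_meanD (has_mean_cst 1) hs.
have [|w|m hm _] := has_mean_dominated _ _ h1 (X := fun w => S w ord0 i).
- exact: measurable_row_comp.
- have := le_sqr_norm2 (S w) i; have := sqr_ge0 (`|S w ord0 i| - 1).
  rewrite sqrrB expr1n real_normK ?num_real// mulr1.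
  have := normr_ge0 (S w ord0 i); lra.
by rewrite mxE (has_mean_expectation hm).
Qed.

(** The descent lemma averaged over a random step. No upper bound on [Phi] is
    assumed: subtracting the lower bound [b] makes the integral meaningful. *)
Lemma descent_mean {d : nat} (Phi : 'rV[R]_d -> R) (K b s : R) (x mu : 'rV[R]_d)
    (S : Omega -> 'rV[R]_d) :
  measurable_fun setT Phi -> (forall y, differentiable Phi y) ->
  lipschitz_grad K Phi -> (forall y, b <= Phi y) ->
  measurable_fun setT S ->
  (forall i, has_mean (fun w => S w ord0 i) (mu ord0 i)) ->
  has_mean (fun w => norm2 (S w) ^+ 2) s ->
  (\int[Q]_w (Phi (x + S w) - b)%:E <=
    (Phi x - b + inner (grad Phi x) mu + K / 2 * s)%:E)%E.
Proof.
move=> mPhi dPhi lipPhi bPhi mS hmu hs.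
have hU := has_meanD (has_meanD (has_mean_cst (Phi x - b))
  (has_mean_inner (grad Phi x) hmu)) (has_meanZ (K / 2) hs).
have [iU <-] := hU.
have mX : measurable_fun setT (fun w => Phi (x + S w) - b).
  apply: measurable_funB => //.
  apply: (measurableT_comp mPhi); exact: measurable_rowD.
apply: ge0_le_integral => //.
- by move=> w _; rewrite lee_fin subr_ge0.
- exact/measurable_EFinP.
- exact: measurable_int iU.
- move=> w _; rewrite lee_fin.
  by have := descent_upper x (S w) dPhi lipPhi; lra.
Qed.

End has_mean.

(** * Moments of the random directions *)

(** A bound on the mean of [norm2 z ^+ 2 * `|z_l|] for a direction [z]. It
    depends only on the constants of the direction assumption: [r ^+ 4] or
    [m4] bounds the fourth moments, according to the case. *)
Definition direction_bound {R : realType} (d : nat) (r m4 : R) : R :=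
  d%:R * ((1 + Num.max (r ^+ 4) m4) / 2).

Section direction_moments.
Context {dO : measure_display} {Omega : measurableType dO} {R : realType}.
Variable Q : probability Omega R.
Context {d : nat}.
Variables (z : Omega -> 'rV[R]_d) (r m4 : R).
Hypothesis mz : measurable_fun setT z.
Hypothesis hz : direction_assumption Q z r m4.

Let mzi i : measurable_fun setT (fun w => z w ord0 i).
Proof. exact: measurable_row_comp. Qed.

Lemma direction_fourth_moment i :
  exists2 m, has_mean Q (fun w => z w ord0 i ^+ 4) m & m <= Num.max (r ^+ 4) m4.
Proof.
have mX : measurable_fun setT (fun w => z w ord0 i ^+ 4) by exact: measurable_funX.
apply: has_mean_ge0 => //; first by move=> w; rewrite exprn_even_ge0.
case: hz => _ _ [/(_ i) hr|/(_ i)[_]]; last first.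
  by rewrite unlock => /le_trans; apply; rewrite lee_fin le_max lexx orbT.
apply: (@le_trans _ _ (\int[Q]_w (r ^+ 4)%:E)%E).
  apply: ae_ge0_le_integral => //.
  - by move=> w _; rewrite lee_fin exprn_even_ge0.
  - exact/measurable_EFinP.
  - by move=> w _; rewrite lee_fin exprn_even_ge0.
  - apply: filterS hr => w hw _; rewrite lee_fin.
    rewrite -[leLHS]ger0_norm ?exprn_even_ge0// normrX.
    by apply: lerXn2r => //; rewrite nnegrE ?normr_ge0// (le_trans _ hw).
by rewrite integral_cst//= probability_setT mule1 lee_fin le_max lexx.
Qed.

(** The covariance hypothesis alone does not say that the products are
    integrable; this follows from the finite second moments. *)
Lemma direction_covariance i j :
  has_mean Q (fun w => z w ord0 i * z w ord0 j) (i == j)%:R.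
Proof.
have E2 k : has_mean Q (fun w => z w ord0 k ^+ 2) 1.
  have [|w||m hm _] := @has_mean_ge0 _ _ _ Q (fun w => z w ord0 k ^+ 2) 1.
  - exact: measurable_funX.
  - exact: sqr_ge0.
  - case: hz => _ /(_ k k) + _; rewrite unlock eqxx => <-.
    by under eq_integral do rewrite expr2.
  suff <- : m = 1 by [].
  rewrite -(has_mean_expectation hm); case: hz => _ /(_ k k) + _.
  rewrite eqxx (_ : (fun w => z w ord0 k ^+ 2) =
                    (fun w => z w ord0 k * z w ord0 k)).
    by move=> ->.
  by apply/funext => w; rewrite expr2.
have hY := has_meanZ 2^-1 (has_meanD (E2 i) (E2 j)).
have [||m hm _] := has_mean_dominated _ _ hY
  (X := fun w => z w ord0 i * z w ord0 j).
- exact: measurable_funM.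
- move=> w; rewrite ler_norml; apply/andP; split.
    by have := sqr_ge0 (z w ord0 i + z w ord0 j); rewrite sqrrD; lra.
  by have := sqr_ge0 (z w ord0 i - z w ord0 j); rewrite sqrrB; lra.
suff <- : m = (i == j)%:R by [].
rewrite -(has_mean_expectation hm); case: hz => _ /(_ i j) + _.
by move=> ->.
Qed.

(** The mean of the exact step [(F x - F (x + a z)) z] differs from the
    gradient step by a term of order [a ^ 2]. *)
Lemma direction_bias (F : 'rV[R]_d -> R) (K : R) x (a : R) l :
  0 <= K -> measurable_fun setT F -> (forall y, differentiable F y) ->
  lipschitz_grad K F ->
  exists2 mu, has_mean Q (fun w => (F x - F (x + a *: z w)) * z w ord0 l) mu &
    `|mu + a * grad F x ord0 l| <=
      K / 2 * a ^+ 2 * direction_bound d r m4.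
Proof.
move=> K0 mF dF lipF.
have /choice[m hm] i : exists m, has_mean Q (fun w => z w ord0 i ^+ 4) m /\
    m <= Num.max (r ^+ 4) m4.
  by have [m ? ?] := direction_fourth_moment i; exists m.
(* the first-order part of the exact step, whose mean is the gradient step *)
pose Y w := - a * inner (grad F x) (z w) * z w ord0 l.
have hY : has_mean Q Y (- a * grad F x ord0 l).
  have := has_meanZ (- a) (has_mean_sum (index_enum 'I_d) (fun i =>
    has_meanZ (grad F x ord0 i) (direction_covariance i l))).
  rewrite (bigD1 l)//= eqxx mulr1 big1 ?addr0 => [|i /negPf ->]; last by rewrite mulr0.
  apply: has_mean_ext => w; rewrite /Y -mulrA; congr (_ * _).
  by rewrite mulr_suml; apply: eq_bigr => i _; rewrite mulrA.
pose X w := (F x - F (x + a *: z w)) * z w ord0 l.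
have mx : measurable_fun setT (fun w => x + a *: z w).
  by apply: measurable_rowD => //; exact: measurable_rowZ.
have mX : measurable_fun setT X.
  apply: measurable_funM => //; apply: measurable_funB => //.
  exact: (measurableT_comp mF).
have mY : measurable_fun setT Y.
  exact: has_mean_measurable hY.
(* dominates [2 * norm2 z ^+ 2 * `|z_l|], by Young's inequality *)
pose W w := \sum_i (z w ord0 i * z w ord0 i +
  2^-1 * (z w ord0 i ^+ 4 + z w ord0 l ^+ 4)).
pose mW := \sum_(i : 'I_d) ((i == i)%:R + 2^-1 * (m i + m l)).
have hW : has_mean Q W mW.
  apply: has_mean_sum => i; apply: has_meanD; first exact: direction_covariance.
  by apply: has_meanZ; apply: has_meanD; exact: (hm _).1.
have := has_meanZ (K / 2 * a ^+ 2 / 2) hW.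
case/(has_mean_dominated _ _ (X := fun w => X w - Y w)).
- exact: measurable_funB.
- move=> w; rewrite /X /Y.
  set p := inner _ _; set zl := z w ord0 l.
  have -> : (F x - F (x + a *: z w)) * zl - - a * p * zl =
      - (F (x + a *: z w) - F x - inner (grad F x) (a *: z w)) * zl.
    by rewrite innerZr -/p; ring.
  rewrite normrM normrN.
  apply: (@le_trans _ _ (K / 2 * norm2 (a *: z w) ^+ 2 * `|zl|)).
    by rewrite ler_wpM2r// descent_abs.
  rewrite norm2Z exprMn real_normK ?num_real//.
  rewrite [leLHS](_ : _ = K / 2 * a ^+ 2 * (norm2 (z w) ^+ 2 * `|zl|)); last by ring.
  rewrite [leRHS](_ : _ = K / 2 * a ^+ 2 * (2^-1 * W w)); last by ring.
  apply: ler_wpM2l.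
    by rewrite mulr_ge0 ?sqr_ge0// divr_ge0.
  rewrite sqr_norm2 /inner /W mulr_suml mulr_sumr; apply: ler_sum => i _.
  rewrite -/zl; set y := z w ord0 i.
  have h1 : `|zl| <= (1 + zl ^+ 2) / 2.
    have := sqr_ge0 (`|zl| - 1); rewrite sqrrB expr1n real_normK ?num_real//; lra.
  have h2 : 0 <= y * y by rewrite -expr2 sqr_ge0.
  have := ler_wpM2l h2 h1; have := sqr_ge0 (y ^+ 2 - zl ^+ 2).
  move=> h3 h4; apply: le_trans h4 _.
  suff : 0 <= (y^+2 - zl^+2)^+2 / 4 by lra.
  by rewrite divr_ge0.
move=> dl hdl dle; exists (dl + (- a * grad F x ord0 l)).
  by apply: has_mean_ext (has_meanD hdl hY) => w; rewrite /X subrK.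
rewrite mulNr subrK; apply: le_trans dle _.
rewrite -[K / 2 * a ^+ 2 / 2 * mW]mulrA; apply: ler_wpM2l.
  by rewrite mulr_ge0 ?sqr_ge0// divr_ge0.
rewrite [leLHS]mulrC /direction_bound [leRHS]mulrA ler_wpM2r ?invr_ge0//.
apply: (@le_trans _ _ (\sum_(i < d) (1 + Num.max (r ^+ 4) m4))).
  apply: ler_sum => i _; rewrite eqxx lerD2l.
  have := (hm i).2; have := (hm l).2; lra.
by rewrite sumr_const card_ord -[leLHS]mulr_natl.
Qed.

End direction_moments.

(** * The seeds of one iteration *)

Section seeds_of_one_iteration.
Context {R : realType} {d : nat} {dX dO : measure_display}.
Context {Xi : measurableType dX} {Omega : measurableType dO}.
Variables (P : probability Xi R) (Q : probability Omega R).
Variables (c : scheme) (n q : nat -> nat).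
Variables (xi : nat -> nat -> nat -> {RV Q >-> Xi})
          (zeta : nat -> nat -> {RV Q >-> 'rV[R]_d}).
Hypothesis n_gt0 : forall k, (0 < n k)%N.
Hypothesis q_gt0 : forall k, (0 < q k)%N.
Hypothesis seedsP : seeds_assumption P c n q xi zeta.

Local Notation seed := ((nat * nat * nat) + (nat * nat))%type.

(** The iteration that draws a seed. *)
Definition seed_index (s : seed) : nat :=
  match s with inl (k, _, _) => k | inr (k, _) => k end.

(** Whether a seed is a direction rather than a data sample. *)
Definition is_direction (s : seed) : bool := if s is inr _ then true else false.

(** Generates the sigma-algebra of the seeds in [B]. *)
Definition seed_sigma (B : set seed) : set (set Omega) :=
  \bigcup_(s in B) seed_events xi zeta s.

Lemma preimage_system_sigma dT (T : measurableType dT) (X : {RV Q >-> T}) :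
  [/\ preimage_set_system setT X measurable `<=` measurable,
      preimage_set_system setT X measurable setT &
      setI_closed (preimage_set_system setT X measurable)].
Proof.
split=> [_ [A mA <-]||_ _ [A mA <-] [B mB <-]].
- exact: measurable_funP.
- by exists setT => //; rewrite preimage_setT setIT.
- exists (A `&` B); first exact: measurableI.
  by rewrite !setTI preimage_setI.
Qed.

Lemma seed_events_sigma s :
  [/\ seed_events xi zeta s `<=` measurable, seed_events xi zeta s setT &
      setI_closed (seed_events xi zeta s)].
Proof. by case: s => [[[k i] j]|[k i]]; exact: preimage_system_sigma. Qed.

Lemma seed_sigma_measurable B : seed_sigma B `<=` measurable.
Proof. by move=> A [s _ sA]; have [h _ _] := seed_events_sigma s; exact: h. Qed.

Lemma independent_seed_sigma B B' :
  B `<=` [set s | drawn c n q s] -> B' `<=` [set s | drawn c n q s] ->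
  B `&` B' = set0 ->
  independent_systems Q <<s seed_sigma B >> <<s seed_sigma B' >>.
Proof.
move=> BD B'D BB'; case: seedsP => _ _ indep.
apply: (independent_blocks _ _ _ indep BD B'D BB') => s;
  by have [] := seed_events_sigma s.
Qed.

Lemma measurable_direction B k i : B (inr (k, i)) ->
  measurable_fun [set: g_sigma_algebraType (seed_sigma B)]
    (zeta k i : g_sigma_algebraType (seed_sigma B) -> 'rV[R]_d).
Proof.
move=> Bs _ A mA; apply: sub_sigma_algebra; exists (inr (k, i)) => //.
by exists A.
Qed.

Lemma measurable_data B k i j : B (inl (k, i, j)) ->
  measurable_fun [set: g_sigma_algebraType (seed_sigma B)]
    (xi k i j : g_sigma_algebraType (seed_sigma B) -> Xi).
Proof.
move=> Bs _ A mA; apply: sub_sigma_algebra; exists (inl (k, i, j)) => //.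
by exists A.
Qed.

(** Fubini's theorem for seeds split into two disjoint groups: the mean may be
    computed by averaging the second group first, with the first one frozen. *)
Lemma has_mean_fubini B B' (h : g_sigma_algebraType (seed_sigma B) *
    g_sigma_algebraType (seed_sigma B') -> R) (g : Omega -> R) mu :
  B `<=` [set s | drawn c n q s] -> B' `<=` [set s | drawn c n q s] ->
  B `&` B' = set0 ->
  measurable_fun setT h -> Q.-integrable setT (fun w => (h (w, w))%:E) ->
  (forall w, has_mean Q (fun w' => h (w, w')) (g w)) -> has_mean Q g mu ->
  has_mean Q (fun w => h (w, w)) mu.
Proof.
move=> BD B'D BB' mh ih hg [_ Eg]; split=> //.
have ind := independent_seed_sigma BD B'D BB'.
have mh' : measurable_fun setT (EFin \o h) by exact/measurable_EFinP.
rewrite (fubini_independent (@seed_sigma_measurable B)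
  (@seed_sigma_measurable B') ind mh')//=.
  by rewrite -Eg; apply: eq_integral => w _; have [_ ->] := hg w.
by move=> w; have [] := hg w.
Qed.

Variables (f : 'rV[R]_d -> Xi -> R) (F : 'rV[R]_d -> R).
Hypothesis f_meas : measurable_fun [set: 'rV[R]_d * Xi] (fun p => f p.1 p.2).
Hypothesis f_int : forall u, P.-integrable setT (fun z => (f u z)%:E).
Hypothesis F_def : forall u, (F u)%:E = 'E_P[f u]%E.

Lemma has_mean_data k i j u : drawn c n q (inl (k, i, j)) ->
  has_mean Q (fun w => f u (xi k i j w)) (F u).
Proof.
move=> dr; case: seedsP => /(_ _ _ _ dr) law _ _.
have mfu : measurable_fun setT (f u) by exact: (measurable_fun_pair2 _ f_meas).
have mfu' : measurable_fun setT (EFin \o f u) by exact/measurable_EFinP.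
have iQ : Q.-integrable setT ((EFin \o f u) \o xi k i j).
  apply/integrableP; split; first exact: measurableT_comp.
  rewrite -(ge0_integral_distribution (xi k i j)
    (f := fun y => `|(f u y)%:E|%E))//; last first.
    exact: measurableT_comp.
  rewrite (eq_measure_integral P); last by move=> A mA _; exact: law.
  by case/integrableP: (f_int u).
split; first exact: iQ.
rewrite F_def unlock -(integral_distribution mfu' iQ).
by apply: eq_measure_integral => A mA _; exact: law.
Qed.

Variables (L r m4 : R).
Hypothesis L_ge0 : 0 <= L.
Hypothesis F_diff : forall y, differentiable F y.
Hypothesis F_lip : lipschitz_grad L F.
Hypothesis zetaP : forall k i, (i < outer_size c (n k) (q k))%N ->
     direction_assumption Q (zeta k i) r m4.

(** The mean of a step from the fixed point [u], for all four schemes. Only the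
    whole step is known to be integrable, not its summands, so the data are
    averaged first, with the directions frozen: this replaces [f] by [F]. *)
Lemma step_mean k (a : R) u l :
  let S w := sgfd_step f c (n k) (q k) (fun i j => xi k i j w)
               (fun i => zeta k i w) a u in
  Q.-integrable setT (fun w => (S w ord0 l)%:E) ->
  exists2 mu, has_mean Q (fun w => S w ord0 l) mu &
    `|mu + a * grad F u ord0 l| <=
      L / 2 * a ^+ 2 * direction_bound d r m4.
Proof.
move=> S iS.
set no := outer_size c (n k) (q k); set ni := inner_size c (n k) (q k).
have no0 : (0 < no)%N by rewrite /no; case: (c) => /=.
have ni0 : (0 < ni)%N by rewrite /ni; case: (c) => /=.
pose B := [set s | drawn c n q s /\ seed_index s = k /\ is_direction s].
pose B' := [set s | drawn c n q s /\ seed_index s = k /\ ~~ is_direction s].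
have mF : measurable_fun setT F by exact: measurable_parametric_mean f_meas F_def.
pose b w i := F u - F (u + a *: zeta k i w).
pose g w := no%:R^-1 * \sum_(i < no) b w i * zeta k i w ord0 l.
set C := L / 2 * a ^+ 2 * _.
have /choice[mu hmu] (i : 'I_no) : exists mu,
    has_mean Q (fun w => b w i * zeta k i w ord0 l) mu /\
    `|mu + a * grad F u ord0 l| <= C.
  have mz : measurable_fun setT (zeta k i) by [].
  have [mu ? ?] := direction_bias mz (zetaP (ltn_ord i)) u a l
    L_ge0 mF F_diff F_lip.
  by exists mu.
have hg : has_mean Q g (no%:R^-1 * \sum_i mu i).
  by apply: has_meanZ; apply: has_mean_sum => i; exact: (hmu i).1.
exists (no%:R^-1 * \sum_i mu i); last first.
  have -> : no%:R^-1 * \sum_i mu i + a * grad F u ord0 l =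
      no%:R^-1 * \sum_i (mu i + a * grad F u ord0 l).
    rewrite big_split/= sumr_const card_ord -[(a * _) *+ no]mulr_natl mulrDr.
    by rewrite mulKf// pnatr_eq0 -lt0n.
  rewrite normrM ger0_norm ?invr_ge0// mulrC ler_pdivrMr ?ltr0n//.
  apply: le_trans (ler_norm_sum _ _ _) _.
  apply: le_trans (ler_sum _ (fun i _ => (hmu i).2)) _.
  by rewrite sumr_const card_ord mulr_natr.
pose h (p : g_sigma_algebraType (seed_sigma B) *
            g_sigma_algebraType (seed_sigma B')) :=
  sgfd_step f c (n k) (q k) (fun i j => xi k i j p.2) (fun i => zeta k i p.1)
    a u ord0 l.
apply: (@has_mean_fubini B B' h g) => //.
- by move=> s [].
- by move=> s [].
- by rewrite -subset0 => s [[_ [_ si]] [_ [_ /negP]]].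
- have mxi i j : (i < no)%N -> (j < ni)%N -> measurable_fun
      [set: g_sigma_algebraType (seed_sigma B) *
            g_sigma_algebraType (seed_sigma B')]
      (fun p => xi k i j p.2 : Xi).
    move=> io ji; apply: (measurableT_comp (@measurable_data B' k i j _)
      measurable_snd).
    by [].
  have mzeta i : (i < no)%N -> measurable_fun
      [set: g_sigma_algebraType (seed_sigma B) *
            g_sigma_algebraType (seed_sigma B')]
      (fun p => zeta k i p.1 : 'rV[R]_d).
    move=> io; apply: (measurableT_comp (@measurable_direction B k i _)
      measurable_fst).
    by [].
  have ms := measurable_sgfd_step a (n_gt0 k) (q_gt0 k) f_meas mxi mzeta
    (measurable_cst u).
  exact: (measurable_row_comp l ms).
- move=> w; rewrite /h /=.
  apply: (@has_mean_ext _ _ _ Q (fun w' => no%:R^-1 * \sum_(i < no)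
     (ni%:R^-1 * zeta k i w ord0 l) * \sum_(j < ni)
       (f u (xi k i j w') - f (u + a *: zeta k i w) (xi k i j w')))).
    move=> w'; rewrite sgfd_stepE// mxE summxE; congr (_ * _).
    by apply: eq_bigr => i _; rewrite mxE -/ni; ring.
  apply: has_meanZ.
  have hh (i : 'I_no) := has_meanZ (ni%:R^-1 * zeta k i w ord0 l)
    (has_mean_sum (index_enum 'I_ni) (fun j : 'I_ni =>
      has_meanD (has_mean_data u (conj (ltn_ord i) (ltn_ord j)))
      (has_meanZ (-1) (has_mean_data (u + a *: zeta k i w)
        (conj (ltn_ord i) (ltn_ord j)))))).
  have := has_mean_sum (index_enum 'I_no) hh.
  rewrite [X in has_mean _ _ X](_ : _ =
      \sum_(i < no) b w i * zeta k i w ord0 l).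
    apply: has_mean_ext => w'; apply: eq_bigr => i _; congr (_ * _).
    by apply: eq_bigr => j _; rewrite mulN1r.
  apply: eq_bigr => i _; rewrite sumr_const card_ord mulN1r -/(b w i).
  rewrite -[b w i *+ ni]mulr_natl.
  by field; rewrite pnatr_eq0 -lt0n.
Qed.

End seeds_of_one_iteration.

(** * One step from a fixed point *)

(** The elementary inequalities behind the two recursions. Here [G] is the
    square norm of the gradient, [e2] the square of the bias of the mean step
    and [s] the second moment of the step. *)
Section recursion_inequalities.
Context {R : realType}.
Variables (a a0 L L_G M M_V c2 : R).
Hypotheses (a_gt0 : 0 < a) (a_le : a <= a0).
Hypotheses (L_gt0 : 0 < L) (LG_gt0 : 0 < L_G) (MV_ge0 : 0 <= M_V).
Hypothesis (c2_ge0 : 0 <= c2).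
Variables (G e2 s : R).
Hypotheses (G_ge0 : 0 <= G) (e2_le : e2 <= c2 * a ^+ 4).
Hypothesis s_le :
  s <= a ^+ 2 * M + a ^+ 2 * M_V * G + (2 * (a ^+ 2 * G) + 2 * e2).

Let e2_quad : e2 <= c2 * a0 ^+ 2 * a ^+ 2.
Proof.
apply: le_trans e2_le _; rewrite -mulrA ler_wpM2l//.
have -> : a ^+ 4 = a ^+ 2 * a ^+ 2 by ring.
by rewrite ler_wpM2r ?sqr_ge0// lerXn2r ?nnegrE// ltW// (lt_le_trans a_gt0).
Qed.

Let e2_div : e2 / a <= c2 * a0 * a ^+ 2.
Proof.
rewrite ler_pdivrMr//; apply: le_trans e2_le _.
have -> : c2 * a0 * a ^+ 2 * a = c2 * a ^+ 3 * a0 by ring.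
have -> : c2 * a ^+ 4 = c2 * a ^+ 3 * a by ring.
by rewrite ler_wpM2l// mulr_ge0// exprn_ge0// ltW.
Qed.

Lemma decrease_bound pe : a * (L * (M_V + 2)) <= 1 ->
  pe <= (a / 2 * G + e2 / (a / 2)) / 2 ->
  - a * G + pe + L / 2 * s <=
    - (a / 4 * G) + (L * M / 2 + c2 * a0 + L * c2 * a0 ^+ 2) * a ^+ 2.
Proof.
move=> aL pele.
have h1 : L / 2 * s <=
    L / 2 * (a ^+ 2 * M + a ^+ 2 * M_V * G + (2 * (a ^+ 2 * G) + 2 * e2)).
  by rewrite ler_wpM2l// divr_ge0// ltW.
have h2 : a / 2 * G * (a * (L * (M_V + 2))) <= a / 2 * G * 1.
  by rewrite ler_wpM2l// mulr_ge0// divr_ge0// ltW.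
have h3 := ler_wpM2l (ltW L_gt0) e2_quad.
have h4 : pe <= a / 4 * G + e2 / a.
  apply: le_trans pele _; rewrite le_eqVlt; apply/orP; left; apply/eqP.
  by field; rewrite gt_eqF.
have := e2_div; lra.
Qed.

Lemma growth_bound gp ge g2 : g2 <= 2 * L_G * G ->
  gp <= (1 * g2 + G / 1) / 2 -> ge <= (a * g2 + e2 / a) / 2 ->
  a * gp + ge + L_G / 2 * s <=
    ((2 * L_G + 1) / 2 + L_G + L_G / 2 * (M_V + 2) * a0) * a * G +
    (c2 * a0 / 2 + L_G / 2 * M + L_G * c2 * a0 ^+ 2) * a ^+ 2.
Proof.
move=> g2le gple gele.
have h1 : L_G / 2 * s <=
    L_G / 2 * (a ^+ 2 * M + a ^+ 2 * M_V * G + (2 * (a ^+ 2 * G) + 2 * e2)).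
  by rewrite ler_wpM2l// divr_ge0// ltW.
have h2 : a * gp <= a * ((1 * (2 * L_G * G) + G / 1) / 2).
  rewrite ler_pM2l//; apply: le_trans gple _; lra.
have h3 := ler_wpM2l (ltW LG_gt0) e2_quad.
have h4 : a * g2 <= a * (2 * L_G * G) by rewrite ler_pM2l.
have h5 : L_G / 2 * (M_V + 2) * a * G * a <= L_G / 2 * (M_V + 2) * a * G * a0.
  by rewrite ler_wpM2l// !mulr_ge0// ?addr_ge0// ltW.
have := e2_div; lra.
Qed.

End recursion_inequalities.

Section conditional_step.
Context {R : realType} {d : nat} {dX dO : measure_display}.
Context {Xi : measurableType dX} {Omega : measurableType dO}.
Variables (P : probability Xi R) (Q : probability Omega R).
Variables (c : scheme) (n q : nat -> nat).
Variables (xi : nat -> nat -> nat -> {RV Q >-> Xi})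
          (zeta : nat -> nat -> {RV Q >-> 'rV[R]_d}).
Hypothesis n_gt0 : forall k, (0 < n k)%N.
Hypothesis q_gt0 : forall k, (0 < q k)%N.
Hypothesis seedsP : seeds_assumption P c n q xi zeta.
Variables (f : 'rV[R]_d -> Xi -> R) (F : 'rV[R]_d -> R).
Hypothesis f_meas : measurable_fun [set: 'rV[R]_d * Xi] (fun p => f p.1 p.2).
Hypothesis f_int : forall u, P.-integrable setT (fun z => (f u z)%:E).
Hypothesis F_def : forall u, (F u)%:E = 'E_P[f u]%E.
Variables (L L_G F_inf M M_V r m4 : R).
Hypothesis L_gt0 : 0 < L.
Hypothesis F_diff : forall y, differentiable F y.
Hypothesis F_lip : lipschitz_grad L F.
Hypothesis F_lb : forall u, F_inf <= F u.
Hypothesis zetaP : forall k i, (i < outer_size c (n k) (q k))%N ->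
     direction_assumption Q (zeta k i) r m4.
Let G v := norm2 (grad F v) ^+ 2.
Hypothesis LG_gt0 : 0 < L_G.
Hypothesis G_diff : forall u, differentiable G u.
Hypothesis G_lip : lipschitz_grad L_G G.
Hypothesis MV_ge0 : 0 <= M_V.

Let c2 : R := d%:R * (L / 2 * direction_bound d r m4) ^+ 2.

(** Conditional form of the two recursions: the objective decreases in mean by
    at least [a / 4 * G u], and [G] grows in mean by at most a multiple of
    [a * G u], both up to an error of order [a ^+ 2]. *)
Lemma conditional_step k (a a0 : R) u : 0 < a -> a <= a0 ->
  a * (L * (M_V + 2)) <= 1 ->
  let S w := sgfd_step f c (n k) (q k) (fun i j => xi k i j w)
               (fun i => zeta k i w) a u in
  (vector_variance Q S <= (a ^+ 2 * M + a ^+ 2 * M_V * G u)%:E)%E ->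
  (\int[Q]_w (F (u + S w) - F_inf)%:E <=
    (F u - F_inf - a / 4 * G u +
     (L * M / 2 + c2 * a0 + L * c2 * a0 ^+ 2) * a ^+ 2)%:E)%E /\
  (\int[Q]_w (G (u + S w))%:E <=
    (G u + ((2 * L_G + 1) / 2 + L_G + L_G / 2 * (M_V + 2) * a0) * a * G u +
     (c2 * a0 / 2 + L_G / 2 * M + L_G * c2 * a0 ^+ 2) * a ^+ 2)%:E)%E.
Proof.
move=> a_gt0 a_le aL S varS.
have mS : measurable_fun setT S.
  have mxi i j : (i < outer_size c (n k) (q k))%N ->
    (j < inner_size c (n k) (q k))%N -> measurable_fun setT (xi k i j) by [].
  have mzeta i : (i < outer_size c (n k) (q k))%N ->
    measurable_fun setT (zeta k i) by [].
  exact: (measurable_sgfd_step a (n_gt0 k) (q_gt0 k) f_meas mxi mzeta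
    (measurable_cst u)).
have mF : measurable_fun setT F by exact: measurable_parametric_mean f_meas F_def.
have mG : measurable_fun setT G by apply: measurable_sqr_norm2; exact: measurable_grad.
have [hmu [s hs sle]] := vector_variance_moments mS varS.
set mu := expected_vector Q S in hmu sle.
pose p := grad F u.
(* the bias of the mean step *)
pose e := mu + a *: p.
have muE : mu = - a *: p + e by rewrite /e scaleNr [mu + _]addrC addKr.
have c2_ge0 : 0 <= c2 by rewrite mulr_ge0// sqr_ge0.
have e2_le : norm2 e ^+ 2 <= c2 * a ^+ 4.
  rewrite sqr_norm2 /inner.
  have -> : c2 * a ^+ 4 = \sum_(l < d)
      (L / 2 * a ^+ 2 * direction_bound d r m4) ^+ 2.
    by rewrite sumr_const card_ord -[RHS]mulr_natl /c2; ring.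
  apply: ler_sum => l _; rewrite -expr2 -real_normK ?num_real//.
  have [iS _] := hmu l.
  have [m hm ml] := step_mean n_gt0 q_gt0 seedsP f_meas f_int F_def
    (ltW L_gt0) F_diff F_lip zetaP (k := k) (a := a) (u := u) iS.
  have -> : e ord0 l = m + a * p ord0 l.
    rewrite !mxE; congr (_ + _); exact: has_mean_expectation hm.
  by apply: lerXn2r => //; rewrite nnegrE ?normr_ge0// (le_trans _ ml).
have s_le : s <= a ^+ 2 * M + a ^+ 2 * M_V * G u +
    (2 * (a ^+ 2 * G u) + 2 * norm2 e ^+ 2).
  apply: le_trans sle _; rewrite lerD2l muE.
  apply: le_trans (sqr_norm2D _ _) _.
  by rewrite norm2Z exprMn real_normK ?num_real// sqrrN.
have G_ge0 v : 0 <= G v by exact: sqr_ge0.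
split.
  apply: le_trans (descent_mean u mF F_diff F_lip F_lb mS hmu hs) _.
  rewrite lee_fin.
  have -> : inner (grad F u) mu = - a * G u + inner p e.
    by rewrite muE innerDr innerZr /G sqr_norm2.
  (* the weight [a / 2] spends a quarter of the decrease [a * G u] on the bias *)
  have := decrease_bound a_gt0 a_le L_gt0 c2_ge0 (G_ge0 u) e2_le s_le aL
    (inner_young p e (divr_gt0 a_gt0 (ltr0Sn R 1))).
  lra.
have := descent_mean u mG G_diff G_lip G_ge0 mS hmu hs.
under eq_integral do rewrite subr0.
move=> /le_trans; apply.
rewrite lee_fin subr0.
have -> : inner (grad G u) mu = a * inner (- grad G u) p + inner (grad G u) e.
  by rewrite muE innerDr innerZr innerNl mulrN mulNr.
have g2 := sqr_norm2_grad_le u LG_gt0 G_diff G_lip G_ge0.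
have gp := inner_young (- grad G u) p ltr01; rewrite norm2N in gp.
have := growth_bound a_gt0 a_le LG_gt0 MV_ge0 c2_ge0 (G_ge0 u) e2_le s_le g2 gp
  (inner_young (grad G u) e a_gt0).
lra.
Qed.

End conditional_step.

(** * The trajectory *)

Section trajectory.
Context {R : realType} {d : nat} {dX dO : measure_display}.
Context {Xi : measurableType dX} {Omega : measurableType dO}.
Variables (P : probability Xi R) (Q : probability Omega R).
Variables (c : scheme) (n q : nat -> nat).
Variables (xi : nat -> nat -> nat -> {RV Q >-> Xi})
          (zeta : nat -> nat -> {RV Q >-> 'rV[R]_d}).
Hypothesis n_gt0 : forall k, (0 < n k)%N.
Hypothesis q_gt0 : forall k, (0 < q k)%N.
Hypothesis seedsP : seeds_assumption P c n q xi zeta.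
Variables (f : 'rV[R]_d -> Xi -> R).
Hypothesis f_meas : measurable_fun [set: 'rV[R]_d * Xi] (fun p => f p.1 p.2).
Variables (x1 : 'rV[R]_d) (x : nat -> Omega -> 'rV[R]_d) (a : nat -> R).
Hypothesis x_init : forall w, x 0%N w = x1.
Hypothesis x_step : forall k w, x k.+1 w = x k w +
     sgfd_step f c (n k) (q k) (fun i j => xi k i j w) (fun i => zeta k i w)
       (a k) (x k w).

(** The seeds of the iterations before [k], which determine [x k]. *)
Definition past_seeds k : set ((nat * nat * nat) + (nat * nat)) :=
  [set s | drawn c n q s /\ (seed_index s < k)%N].

(** The seeds of iteration [k]. *)
Definition present_seeds k : set ((nat * nat * nat) + (nat * nat)) :=
  [set s | drawn c n q s /\ seed_index s = k].

Lemma measurable_seed_sigma_sub B B' dT (T : measurableType dT) (g : Omega -> T) :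
  B `<=` B' ->
  measurable_fun [set: g_sigma_algebraType (seed_sigma xi zeta B)]
    (g : g_sigma_algebraType (seed_sigma xi zeta B) -> T) ->
  measurable_fun [set: g_sigma_algebraType (seed_sigma xi zeta B')]
    (g : g_sigma_algebraType (seed_sigma xi zeta B') -> T).
Proof.
move=> BB' mg _ A mA.
have := mg measurableT A mA; apply: sub_sigma_algebra2.
by move=> E [s Bs Es]; exists s => //; exact: BB'.
Qed.

Lemma measurable_iterate k :
  measurable_fun [set: g_sigma_algebraType (seed_sigma xi zeta (past_seeds k))]
    (x k : g_sigma_algebraType (seed_sigma xi zeta (past_seeds k)) ->
      'rV[R]_d).
Proof.
elim: k => [|k IH].
  by rewrite (_ : x 0 = (fun=> x1)); [exact: measurable_cst|exact/funext].
rewrite (_ : x k.+1 = (fun w => x k w +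
   sgfd_step f c (n k) (q k) (fun i j => xi k i j w) (fun i => zeta k i w)
       (a k) (x k w))); last exact/funext.
have mx : measurable_fun
    [set: g_sigma_algebraType (seed_sigma xi zeta (past_seeds k.+1))]
    (x k : g_sigma_algebraType (seed_sigma xi zeta (past_seeds k.+1)) ->
      'rV[R]_d).
  by apply: measurable_seed_sigma_sub IH => s [? ?]; split => //; exact: ltnW.
apply: measurable_rowD => //.
apply: (measurable_sgfd_step (a k) (n_gt0 k) (q_gt0 k) f_meas _ _ mx).
  by move=> i j io ji; apply: measurable_data; split.
by move=> i io; apply: measurable_direction; split.
Qed.

Lemma measurable_iterateT k : measurable_fun setT (x k).
Proof.
exact: (measurable_fun_sub
  (@seed_sigma_measurable _ _ _ _ _ _ Q xi zeta (past_seeds k))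
  (@measurable_iterate k)).
Qed.

(** Total expectation over iteration [k]: the inner integral freezes the iterate
    and averages the seeds of iteration [k], which are independent of it. *)
Lemma mean_next_iterate k (Psi : 'rV[R]_d -> R) :
  measurable_fun setT Psi -> (forall u, 0 <= Psi u) ->
  let J w := (\int[Q]_w' (Psi (x k w + sgfd_step f c (n k) (q k)
    (fun i j => xi k i j w') (fun i => zeta k i w') (a k) (x k w)))%:E)%E in
  measurable_fun setT J /\
  (\int[Q]_w (Psi (x k.+1 w))%:E = \int[Q]_w J w)%E.
Proof.
move=> mPsi Psi0 J.
pose O1 := g_sigma_algebraType (seed_sigma xi zeta (past_seeds k)).
pose O2 := g_sigma_algebraType (seed_sigma xi zeta (present_seeds k)).
pose h (p : O1 * O2) := (Psi (x k p.1 + sgfd_step f c (n k) (q k)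
    (fun i j => xi k i j p.2) (fun i => zeta k i p.2) (a k) (x k p.1)))%:E.
have ind : independent_systems Q <<s seed_sigma xi zeta (past_seeds k) >>
    <<s seed_sigma xi zeta (present_seeds k) >>.
  apply: independent_seed_sigma; [exact: seedsP|by move=> s []|by move=> s []|].
  by rewrite -subset0 => s [[_ +] [_ sk]]; rewrite sk ltnn.
have mx : measurable_fun [set: O1 * O2] (fun p => x k p.1).
  exact: (measurableT_comp (@measurable_iterate k) measurable_fst).
have mh : measurable_fun [set: O1 * O2] h.
  apply/measurable_EFinP; apply: (measurableT_comp mPsi).
  apply: measurable_rowD => //.
  have mxi i j : (i < outer_size c (n k) (q k))%N ->
      (j < inner_size c (n k) (q k))%N ->
      measurable_fun [set: O1 * O2] (fun p => xi k i j p.2 : Xi).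
    move=> io ji; apply: (measurableT_comp (@measurable_data _ _ _ _ _ _ Q xi zeta
      (present_seeds k) k i j _) measurable_snd).
    by [].
  have mzeta i : (i < outer_size c (n k) (q k))%N ->
      measurable_fun [set: O1 * O2] (fun p => zeta k i p.2 : 'rV[R]_d).
    move=> io; apply: (measurableT_comp (@measurable_direction _ _ _ _ _ _ Q xi zeta
      (present_seeds k) k i _) measurable_snd).
    by [].
  exact: (measurable_sgfd_step (a k) (n_gt0 k) (q_gt0 k) f_meas mxi mzeta mx).
have h0 p : (0 <= h p)%E by rewrite lee_fin.
have Gm B := @seed_sigma_measurable _ _ _ _ _ _ Q xi zeta B.
split; first exact: (measurable_partial_integral Q (Gm _) (Gm _) mh h0).
rewrite -(tonelli_independent (Gm _) (Gm _) ind mh h0).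
by apply: eq_integral => w _; rewrite x_step.
Qed.

End trajectory.

Theorem theorem3p12 (R : realType) (d : nat) (dX dO : measure_display)
  (Xi : measurableType dX) (Omega : measurableType dO)
  (P : probability Xi R) (Q : probability Omega R)
  (f : 'rV[R]_d -> Xi -> R) (F : 'rV[R]_d -> R)
  (c : scheme) (n q : nat -> nat)
  (xi : nat -> nat -> nat -> {RV Q >-> Xi})
  (zeta : nat -> nat -> {RV Q >-> 'rV[R]_d})
  (x1 : 'rV[R]_d) (x : nat -> Omega -> 'rV[R]_d)
  (L L_G F_inf M M_V r_zeta m4_zeta beta sigma : R)
  (f_meas : measurable_fun [set: 'rV[R]_d * Xi] (fun p => f p.1 p.2))
  (f_int : forall u, P.-integrable setT (fun z => (f u z)%:E))
  (F_def : forall u, (F u)%:E = 'E_P[f u]%E)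
  (* (A) *)
  (L_gt0 : 0 < L)
  (F_C1 : continuously_differentiable F)
  (F_lip : lipschitz_grad L F)
  (* (B) *)
  (F_D2 : twice_differentiable F)
  (F_lb : forall u, F_inf <= F u)
  (LG_gt0 : 0 < L_G)
  (G_diff : forall u, differentiable (fun v => norm2 (grad F v) ^+ 2) u)
  (G_lip : lipschitz_grad L_G (fun v => norm2 (grad F v) ^+ 2))
  (* the SGFD method *)
  (n_gt0 : forall k, (0 < n k)%N)
  (q_gt0 : forall k, (0 < q k)%N)
  (seedsP : seeds_assumption P c n q xi zeta)
  (beta_gt0 : 0 < beta)
  (sigma_gt0 : 0 < sigma)
  (x_init : forall w, x 0%N w = x1)
  (x_step : forall k w, x k.+1 w = x k w +
     sgfd_step f c (n k) (q k) (fun i j => xi k i j w) (fun i => zeta k i w)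
       (stepsize beta sigma k) (x k w))
  (* (C) *)
  (zetaP : forall k i, (i < outer_size c (n k) (q k))%N ->
     direction_assumption Q (zeta k i) r_zeta m4_zeta)
  (* (D): the iterate is frozen at x k w, and only the seeds w' of
     iteration k are averaged *)
  (M_ge0 : 0 <= M)
  (MV_ge0 : 0 <= M_V)
  (varP : forall k, {ae Q, forall w,
     (vector_variance Q (fun w' =>
        sgfd_step f c (n k) (q k) (fun i j => xi k i j w')
          (fun i => zeta k i w') (stepsize beta sigma k) (x k w))
      <= (stepsize beta sigma k ^+ 2 * M
          + stepsize beta sigma k ^+ 2 * M_V
            * norm2 (grad F (x k w)) ^+ 2)%:E)%E})
  (alpha1_le : stepsize beta sigma 0 <= 1 / (L * (M_V + 2))) :
  (fun k => 'E_Q[fun w => (norm2 (grad F (x k w)) ^+ 2)%R]%E) @ \oo --> (0%E : \bar R).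
Proof.
have [F_diff _] := F_C1.
have mF : measurable_fun setT F by exact: measurable_parametric_mean f_meas F_def.
pose G v := norm2 (grad F v) ^+ 2.
have mG : measurable_fun setT G by apply: measurable_sqr_norm2; exact: measurable_grad.
pose al := stepsize beta sigma.
have al0 k : 0 < al k by rewrite /al/stepsize divr_gt0// ltr_pwDr// ler0n.
have al_le k : al k <= al 0.
  rewrite /al /stepsize ler_wpM2l ?(ltW beta_gt0)// lef_pV2 ?posrE ?ltr_pwDr ?ler0n//.
  by rewrite lerD2r ler_nat.
have LM0 : 0 < L * (M_V + 2) by rewrite mulr_gt0// ltr_wpDl.
have alL k : al k * (L * (M_V + 2)) <= 1.
  by rewrite -ler_pdivlMr//; exact: le_trans (al_le k) alpha1_le.
have G_ge0 v : 0 <= G v by exact: sqr_ge0.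
pose c2 : R := d%:R * (L / 2 * direction_bound d r_zeta m4_zeta) ^+ 2.
have c2_ge0 : 0 <= c2 by rewrite mulr_ge0// sqr_ge0.
pose B : R := L * M / 2 + c2 * al 0 + L * c2 * al 0 ^+ 2.
pose C : R := (2 * L_G + 1) / 2 + L_G + L_G / 2 * (M_V + 2) * al 0.
pose D : R := c2 * al 0 / 2 + L_G / 2 * M + L_G * c2 * al 0 ^+ 2.
have a00 := ltW (al0 0); have L0 := ltW L_gt0; have LG0 := ltW LG_gt0.
have b0 := ltW beta_gt0; have s0 := ltW sigma_gt0.
have B0 : 0 <= B by rewrite !(sqr_ge0, addr_ge0, mulr_ge0, invr_ge0).
have C0 : 0 <= C by rewrite !(sqr_ge0, addr_ge0, mulr_ge0, invr_ge0).
have D0 : 0 <= D by rewrite !(sqr_ge0, addr_ge0, mulr_ge0, invr_ge0).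
have mx k : measurable_fun setT (x k).
  exact: (@measurable_iterateT _ _ _ _ _ _ Q c n q xi zeta n_gt0 q_gt0 f f_meas
    x1 x _ x_init x_step k).
pose A k := (\int[Q]_w (F (x k w) - F_inf)%:E)%E.
pose g k := (\int[Q]_w (G (x k w))%:E)%E.
have A_ge0 k : (0 <= A k)%E.
  by apply: integral_ge0 => w _; rewrite lee_fin subr_ge0.
have g_ge0 k : (0 <= g k)%E by apply: integral_ge0 => w _; rewrite lee_fin.
have mFx k : measurable_fun setT (fun w => (F (x k w) - F_inf)%:E).
  by apply/measurable_EFinP; apply: measurable_funB => //; exact: measurableT_comp (mx k).
have mGx k : measurable_fun setT (fun w => (G (x k w))%:E).
  by apply/measurable_EFinP; exact: measurableT_comp (mx k).
(* the bounds at one point, with constants independent of [k], as [al k <= al 0] *)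
have cond k u :
    let S w := sgfd_step f c (n k) (q k) (fun i j => xi k i j w)
                 (fun i => zeta k i w) (al k) u in
    (vector_variance Q S <= (al k ^+ 2 * M + al k ^+ 2 * M_V * G u)%:E)%E ->
    (\int[Q]_w (F (u + S w) - F_inf)%:E <=
      (F u - F_inf - al k / 4 * G u + B * al k ^+ 2)%:E)%E /\
    (\int[Q]_w (G (u + S w))%:E <=
      (G u + C * al k * G u + D * al k ^+ 2)%:E)%E.
  exact: (conditional_step n_gt0 q_gt0 seedsP f_meas f_int F_def L_gt0 F_diff F_lip
    F_lb zetaP LG_gt0 G_diff G_lip MV_ge0 (al0 k) (al_le k) (alL k)).
have decr k : (A k.+1 + (al k / 4)%:E * g k <= A k + (B * al k ^+ 2)%:E)%E.
  have mPsi : measurable_fun setT (fun u => F u - F_inf) by exact: measurable_funB.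
  have Psi0 u : 0 <= F u - F_inf by rewrite subr_ge0.
  have [mJ EJ] := mean_next_iterate n_gt0 q_gt0 seedsP f_meas x_init x_step k
    mPsi Psi0.
  rewrite /A EJ /g -ge0_integralZl//; last 2 first.
  - by move=> w _; rewrite lee_fin.
  - by rewrite lee_fin divr_ge0// ltW.
  rewrite -ge0_integralD//; last 3 first.
  - by move=> w _; apply: integral_ge0 => w' _; rewrite lee_fin.
  - by move=> w _; rewrite mule_ge0// lee_fin// divr_ge0// ltW.
  - exact: measurable_funeM.
  have -> : (B * al k ^+ 2)%:E = (\int[Q]_w (B * al k ^+ 2)%:E)%E.
    by rewrite integral_cst//= probability_setT mule1.
  rewrite -ge0_integralD//; last 2 first.
  - by move=> w _; rewrite lee_fin subr_ge0.
  - by move=> w _; rewrite lee_fin mulr_ge0// sqr_ge0.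
  apply: ae_ge0_le_integral => //.
  - move=> w _; apply: adde_ge0; first by apply: integral_ge0 => w' _; rewrite lee_fin.
    by rewrite mule_ge0// lee_fin// divr_ge0// ltW.
  - by apply: emeasurable_funD => //; exact: measurable_funeM.
  - by move=> w _; rewrite -EFinD lee_fin addr_ge0// ?subr_ge0// mulr_ge0// sqr_ge0.
  - exact: emeasurable_funD.
  apply: filterS (varP k) => w hw _.
  have [h _] := cond k (x k w) hw.
  apply: le_trans (leeD h (lexx _)) _.
  by rewrite -!EFinM -!EFinD lee_fin; lra.
have grow k : (g k.+1 <= g k + (C * al k)%:E * g k + (D * al k ^+ 2)%:E)%E.
  have [mJ EJ] := mean_next_iterate n_gt0 q_gt0 seedsP f_meas x_init x_step k
    mG G_ge0.
  rewrite /g EJ -ge0_integralZl//; last 2 first.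
  - by move=> w _; rewrite lee_fin.
  - by rewrite lee_fin mulr_ge0// ltW.
  have Cg0 w : (0 <= (C * al k)%:E * (G (x k w))%:E)%E.
    by rewrite mule_ge0// lee_fin// mulr_ge0// ltW.
  have mCg : measurable_fun setT (fun w => (C * al k)%:E * (G (x k w))%:E)%E.
    exact: measurable_funeM.
  rewrite -ge0_integralD//; last first.
    by move=> w _; rewrite lee_fin.
  have -> : (D * al k ^+ 2)%:E = (\int[Q]_w (D * al k ^+ 2)%:E)%E.
    by rewrite integral_cst//= probability_setT mule1.
  rewrite -ge0_integralD//; last 3 first.
  - by move=> w _; rewrite adde_ge0// lee_fin.
  - exact: emeasurable_funD.
  - by move=> w _; rewrite lee_fin mulr_ge0// sqr_ge0.
  apply: ae_ge0_le_integral => //.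
  - by move=> w _; apply: integral_ge0 => w' _; rewrite lee_fin.
  - by move=> w _; rewrite adde_ge0// ?adde_ge0// lee_fin// mulr_ge0// sqr_ge0.
  - by apply: emeasurable_funD => //; exact: emeasurable_funD.
  apply: filterS (varP k) => w hw _.
  have [_ h] := cond k (x k w) hw.
  by apply: le_trans h _; rewrite -!EFinM -!EFinD lee_fin.
have A_fin k : A k \is a fin_num.
  rewrite ge0_fin_numE//; elim: k => [|k IH].
    rewrite /A; under eq_integral do rewrite x_init.
    by rewrite integral_cst//= probability_setT mule1 ltry.
  apply: le_lt_trans (_ : A k + (B * al k ^+ 2)%:E < +oo)%E; last first.
    by rewrite lte_add_pinfty// ltry.
  by apply: le_trans (decr k); rewrite leeDl// mule_ge0// lee_fin divr_ge0// ltW.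
have g_fin k : g k \is a fin_num.
  rewrite ge0_fin_numE// -(@lte_pmul2l _ (al k / 4)%:E)//; last first.
    by rewrite lte_fin divr_gt0.
  rewrite gt0_muley; last by rewrite lte_fin divr_gt0.
  apply: le_lt_trans (_ : A k + (B * al k ^+ 2)%:E < +oo)%E; last first.
    by rewrite lte_add_pinfty ?ltry// ltey_eq A_fin.
  by apply: le_trans (decr k); rewrite leeDr.
suff : fine (g k) @[k --> \oo] --> 0.
  move=> h; rewrite unlock; apply: (@cvg_EFin _ _ _ _ g) => //.
  exact: nearW.
apply: (@cvg0_two_sequences _ beta sigma 4^-1 B C D (fun k => fine (A k))) => //.
- by move=> k; exact: fine_ge0.
- by move=> k; exact: fine_ge0.
- move=> k; have := decr k.
  rewrite -(fineK (A_fin k.+1)) -(fineK (A_fin k)) -(fineK (g_fin k)).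
  by rewrite -EFinM -!EFinD lee_fin [al k / 4]mulrC.
- move=> k; have := grow k.
  rewrite -(fineK (g_fin k.+1)) -(fineK (g_fin k)).
  by rewrite -EFinM -!EFinD lee_fin.
Qed.
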